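(* The group $PBV$ is bi-orderable; that is, there exists a total order $<$ on the set $PBV$ such that for all $a,b,c\in PBV$, $a<b$ implies $ca<cb$ and $ac<bc$.
   Context: Trees: a tree means a finite rooted planar binary tree (every vertex has either $0$ or $2$ ordered children); its leaves are numbered $1,2,\dots,n$ from left to right. Attaching a caret to the $i$-th leaf means giving that leaf two children. Braids: $B_n$ is Artin's braid group on $n$ strands, generated by $\sigma_1,\dots,\sigma_{n-1}$ subject to $\sigma_i\sigma_j=\sigma_j\sigma_i$ if $|i-j|>1$ and $\sigma_i\sigma_j\sigma_i=\sigma_j\sigma_i\sigma_j$ if $|i-j|=1$. $\rho_n:B_n\to S_n$ sends a braid to the permutation it induces on the base points (the strand of $b$ starting at position $i$ ends at position $\rho_n(b)(i)$; products of braids are read from left to right). $P_n=\ker\rho_n$ is the pure braid group. Strand splitting: for $b\in B_n$ and $1\le i\le n$, let $s_i(b)\in B_{n+1}$ be the braid obtained from $b$ by replacing the strand starting at position $i$ by two parallel strands (which do not cross each other). Algebraically, $s_i(1)=1$, $s_i(ab)=s_i(a)\,s_{\rho_n(a)(i)}(b)$, and $s_i(\sigma_j)=\sigma_{j+1}$ if $i<j$, $s_j(\sigma_j)=\sigma_{j+1}\sigma_j$, $s_{j+1}(\sigma_j)=\sigma_j\sigma_{j+1}$, $s_i(\sigma_j)=\sigma_j$ if $i>j+1$. The group $BV$: its elements are equivalence classes of triples $(T_-,b,T_+)$, where $T_-,T_+$ are trees with the same number $n$ of leaves and $b\in B_n$ (the $i$-th strand of $b$ joins leaf $i$ of $T_-$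 to leaf $\rho_n(b)(i)$ of $T_+$). The equivalence relation is generated by $(T_-,b,T_+)\sim(T_-',s_i(b),T_+')$, where $T_-'$ is $T_-$ with a caret attached to leaf $i$ and $T_+'$ is $T_+$ with a caret attached to leaf $\rho_n(b)(i)$. To multiply the classes of $(T_-,b,T_+)$ and $(U_-,c,U_+)$, choose equivalent representatives $(\overline T_-,\overline b,\overline T_+)$ and $(\overline U_-,\overline c,\overline U_+)$ with $\overline T_+=\overline U_-$; the product is the class of $(\overline T_-,\overline b\,\overline c,\overline U_+)$. Thompson's group $V$ is described in the same way by triples $(T_-,\pi,T_+)$ with $\pi\in S_n$ in place of braids, and there is a homomorphism $\widetilde\rho:BV\to V$, $\widetilde\rho(T_-,b,T_+)=(T_-,\rho_n(b),T_+)$. $PBV=\ker\widetilde\rho$; equivalently, $PBV$ is the subgroup of $BV$ of all elements represented by triples $(T,p,T)$ in which the two trees are equal and $p$ is a pure braid. *)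

(* Defs.v *)
From HB Require Import structures.
From Stdlib Require Import Relation_Operators.
From mathcomp Require Import all_boot all_fingroup.
From mathcomp Require Import boolp zify.

Set Implicit Arguments.
Unset Strict Implicit.
Unset Printing Implicit Defensive.

Local Open Scope quotient_scope.
Local Open Scope group_scope.

Local Notation repr := generic_quotient.repr.

Section Presentation.

Variables (X : choiceType) (R : seq (X * bool) -> seq (X * bool) -> Prop).

(* The letter (x, false) stands for x and (x, true) for its inverse. *)
Inductive pres_eq : seq (X * bool) -> seq (X * bool) -> Prop :=
| pres_eq_refl u : pres_eq u u
| pres_eq_sym u v : pres_eq u v -> pres_eq v u
| pres_eq_trans u v w : pres_eq u v -> pres_eq v w -> pres_eq u w
| pres_eq_cat u u' v v' :
    pres_eq u u' -> pres_eq v v' -> pres_eq (u ++ v) (u' ++ v')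
| pres_eq_cancel x e : pres_eq [:: (x, e); (x, ~~ e)] [::]
| pres_eq_rel u v : R u v -> pres_eq u v.

Definition pres_eqb u v : bool := `[< pres_eq u v >].

Lemma pres_eqb_equiv : equiv_class_of pres_eqb.
Proof.
split=> [u|u v|v u w].
- by apply/asboolP; apply: pres_eq_refl.
- by apply/asboolP/asboolP; apply: pres_eq_sym.
- by move=> /asboolP uv /asboolP vw; apply/asboolP; apply: pres_eq_trans vw.
Qed.

Canonical pres_equiv := EquivRelPack pres_eqb_equiv.

Definition presented := {eq_quot pres_equiv}.
HB.instance Definition _ := Choice.on presented.

Definition word_class (w : seq (X * bool)) : presented := \pi w.

Lemma word_classP u v : word_class u = word_class v <-> pres_eq u v.
Proof. by split=> [/eqmodP/asboolP|uv]; last apply/eqmodP/asboolP. Qed.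

Definition word_inv (w : seq (X * bool)) := rev [seq (x.1, ~~ x.2) | x <- w].

Lemma pres_eq_inv u v : pres_eq u v -> pres_eq (word_inv u) (word_inv v).
Proof.
have mulwV w : pres_eq (w ++ word_inv w) [::].
  elim: w => [|[x e] w IH]; first exact: pres_eq_refl.
  rewrite /word_inv /= rev_cons -cats1 -cat_cons catA.
  apply: (pres_eq_trans (v := [:: (x, e)] ++ [:: (x, ~~ e)])).
    apply: pres_eq_cat; last exact: pres_eq_refl.
    rewrite -[(x, e) :: w]cat1s -[[:: (x, e)] in X in pres_eq _ X]cats0 -catA.
    by apply: pres_eq_cat => //; apply: pres_eq_refl.
  exact: pres_eq_cancel.
have invK w : word_inv (word_inv w) = w.
  rewrite /word_inv map_rev revK -map_comp.
  by elim: w => [|[x e] w IH] //=; rewrite negbK IH.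
move=> uv; apply: (pres_eq_trans (v := word_inv u ++ (v ++ word_inv v))).
  rewrite -[X in pres_eq X]cats0; apply: pres_eq_cat; first exact: pres_eq_refl.
  by apply: pres_eq_sym.
rewrite catA; apply: (pres_eq_trans (v := (word_inv u ++ u) ++ word_inv v)).
  apply: pres_eq_cat; last exact: pres_eq_refl.
  by apply: pres_eq_cat; [exact: pres_eq_refl | exact: pres_eq_sym].
rewrite -[X in pres_eq _ X]cat0s; apply: pres_eq_cat; last exact: pres_eq_refl.
by rewrite -[X in _ ++ X]invK.
Qed.

Definition pres_mul (a b : presented) := word_class (repr a ++ repr b).
Definition pres_inv (a : presented) := word_class (word_inv (repr a)).

Lemma word_class_repr a : word_class (repr a) = a.
Proof. exact: reprK. Qed.

Lemma pres_mulE u v :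
  pres_mul (word_class u) (word_class v) = word_class (u ++ v).
Proof.
by apply/word_classP/pres_eq_cat; apply/word_classP; rewrite word_class_repr.
Qed.

Lemma pres_invE u : pres_inv (word_class u) = word_class (word_inv u).
Proof.
by apply/word_classP/pres_eq_inv; apply/word_classP; rewrite word_class_repr.
Qed.

Lemma pres_ind (P : presented -> Prop) :
  (forall w, P (word_class w)) -> forall a, P a.
Proof. by move=> Pw a; rewrite -(word_class_repr a). Qed.

Lemma pres_mulA : associative pres_mul.
Proof.
elim/pres_ind=> u; elim/pres_ind=> v; elim/pres_ind=> w.
by rewrite !pres_mulE catA.
Qed.

Lemma pres_mul1 : left_id (word_class [::]) pres_mul.
Proof. by elim/pres_ind=> u; rewrite pres_mulE. Qed.

Lemma pres_mulr1 : right_id (word_class [::]) pres_mul.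
Proof. by elim/pres_ind=> u; rewrite pres_mulE cats0. Qed.

Lemma pres_mulV : right_inverse (word_class [::]) pres_inv pres_mul.
Proof.
elim/pres_ind=> w; rewrite pres_invE pres_mulE.
elim: w => [|[x e] w IH] //.
rewrite /word_inv /= rev_cons -cats1 -cat_cons catA -!pres_mulE.
rewrite -cat1s -!pres_mulE -(pres_mulA (word_class [:: (x, e)])) pres_mulE.
by rewrite IH pres_mulr1 pres_mulE; apply/word_classP/pres_eq_cancel.
Qed.

Lemma pres_mulVl : left_inverse (word_class [::]) pres_inv pres_mul.
Proof.
elim/pres_ind=> w; rewrite -[X in pres_mul _ X](_ : pres_inv (word_class (word_inv w)) = _).
  by rewrite pres_invE pres_mulV.
rewrite pres_invE; congr word_class.
rewrite /word_inv map_rev revK -map_comp.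
by elim: w => [|[x e] w IH] //=; rewrite negbK IH.
Qed.

HB.instance Definition _ := isGroup.Build presented
  pres_mulA pres_mul1 pres_mulr1 pres_mulVl pres_mulV.

Definition pres_gen (x : X) : presented := word_class [:: (x, false)].

Lemma word_class_cat u v : word_class (u ++ v) = word_class u * word_class v.
Proof. by rewrite -pres_mulE. Qed.

Lemma word_class_letter x e :
  word_class [:: (x, e)] = if e then (pres_gen x)^-1 else pres_gen x.
Proof. by case: e => //; rewrite [RHS]pres_invE. Qed.

End Presentation.

Section Braid.

Variable n : nat.

(* The generator sigma_j of B_n, 0 <= j < n - 1, crosses the strands at the
   positions j and j + 1; positions are numbered from 0. *)
Definition lpos (j : 'I_n.-1) : 'I_n := widen_ord (leq_pred n) j.

Lemma rpos_subproof (j : 'I_n.-1) : j.+1 < n.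
Proof. by rewrite -ltn_predRL. Qed.

Definition rpos (j : 'I_n.-1) : 'I_n := Ordinal (rpos_subproof j).

Inductive artin_rel : seq ('I_n.-1 * bool) -> seq ('I_n.-1 * bool) -> Prop :=
| artin_far (i j : 'I_n.-1) : (i.+1 < j) || (j.+1 < i) ->
    artin_rel [:: (i, false); (j, false)] [:: (j, false); (i, false)]
| artin_adj (i j : 'I_n.-1) : (i.+1 == j) || (j.+1 == i) ->
    artin_rel [:: (i, false); (j, false); (i, false)]
              [:: (j, false); (i, false); (j, false)].

Definition braid := presented artin_rel.
HB.instance Definition _ := Group.on braid.

Definition sigma (j : 'I_n.-1) : braid := pres_gen artin_rel j.

Definition letter_perm (l : 'I_n.-1 * bool) : 'S_n :=
  tperm (lpos l.1) (rpos l.1).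

Definition word_perm (w : seq ('I_n.-1 * bool)) : 'S_n :=
  \prod_(l <- w) letter_perm l.

Definition braid_perm (b : braid) : 'S_n := word_perm (repr b).

End Braid.

Section Split.

Variable n : nat.

(* 'I_n is also the index type of the generators of B_(n+1), so that lpos j and
   rpos j below are the indices j and j + 1. *)
Definition split_sigma (i : 'I_n) (j : 'I_n.-1) : braid n.+1 :=
  if i < j then @sigma n.+1 (rpos j)
  else if i == lpos j then @sigma n.+1 (rpos j) * @sigma n.+1 (lpos j)
  else if i == rpos j then @sigma n.+1 (lpos j) * @sigma n.+1 (rpos j)
  else @sigma n.+1 (lpos j).

(* From 1 = s_i(x^-1 x) one gets s_i(x^-1) = s_k(x)^-1 for k = rho(x^-1)(i). *)
Definition split_letter (i : 'I_n) (l : 'I_n.-1 * bool) : braid n.+1 :=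
  if l.2 then (split_sigma (letter_perm l i) l.1)^-1 else split_sigma i l.1.

Fixpoint split_word (i : 'I_n) (w : seq ('I_n.-1 * bool)) : braid n.+1 :=
  if w is l :: w' then split_letter i l * split_word (letter_perm l i) w'
  else 1.

Definition split (i : 'I_n) (b : braid n) : braid n.+1 := split_word i (repr b).

End Split.

Section NatSigma.

Variable n : nat.

Definition sg (k : nat) : braid n :=
  if insub k is Some j then sigma j else 1.

Lemma sgE (j : 'I_n.-1) : sg j = sigma j.
Proof. by rewrite /sg valK. Qed.

Lemma sg_far i j : i.+1 < j -> sg i * sg j = sg j * sg i.
Proof.
rewrite /sg; case: insubP => [i' _ <-|_ _]; last by rewrite mul1g mulg1.
case: insubP => [j' _ <-|_ _]; last by rewrite mul1g mulg1.
move=> ij; rewrite /sigma /pres_gen -!word_class_cat.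
by apply/word_classP/pres_eq_rel/artin_far; rewrite ij.
Qed.

Lemma sg_adj i : i.+2 < n -> sg i * sg i.+1 * sg i = sg i.+1 * sg i * sg i.+1.
Proof.
move=> lt_i; have lt1 : i < n.-1 by lia.
have lt2 : i.+1 < n.-1 by lia.
have E (x y : 'I_n.-1) : sigma x * sigma y * sigma x
    = word_class (@artin_rel n) [:: (x, false); (y, false); (x, false)].
  rewrite /sigma /pres_gen -(word_class_cat _ [:: (x, false)] [:: (y, false)]).
  by rewrite -(word_class_cat _ [:: (x, false); (y, false)] [:: (x, false)]).
rewrite /sg !insubT !E; apply/word_classP/pres_eq_rel.
by apply: artin_adj; rewrite /= eqxx.
Qed.

End NatSigma.

Definition tpn (j i : nat) := if i == j then j.+1 else if i == j.+1 then j else i.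

Lemma letter_permE n (l : 'I_n.-1 * bool) (i : 'I_n) :
  letter_perm l i = tpn l.1 i :> nat.
Proof.
rewrite /letter_perm /tpn; case: tpermP => [->|->|/eqP + /eqP] /=.
- by rewrite eqxx.
- by rewrite eqxx; case: eqP => // /esym/eqP; rewrite eqn_leq ltnn andbF.
- by rewrite -!val_eqE /= => /negPf-> /negPf->.
Qed.

Definition ssg n (i j : nat) : braid n.+1 :=
  if i < j then sg n.+1 j.+1
  else if i == j then sg n.+1 j.+1 * sg n.+1 j
  else if i == j.+1 then sg n.+1 j * sg n.+1 j.+1
  else sg n.+1 j.

Lemma split_sigmaE n (i : 'I_n) (j : 'I_n.-1) : split_sigma i j = ssg n i j.
Proof. by rewrite /split_sigma /ssg -!sgE -!val_eqE. Qed.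

Lemma tpn_l j i : i = j -> tpn j i = j.+1.
Proof. by move=> ->; rewrite /tpn eqxx. Qed.

Lemma tpn_r j i : i = j.+1 -> tpn j i = j.
Proof. by move=> ->; rewrite /tpn eqxx eqn_leq ltnn. Qed.

Lemma tpn_n j i : i <> j -> i <> j.+1 -> tpn j i = i.
Proof. by move=> /eqP/negPf nj /eqP/negPf nk; rewrite /tpn nj nk. Qed.

Lemma ssg_lt n i j : i < j -> ssg n i j = sg n.+1 j.+1.
Proof. by rewrite /ssg => ->. Qed.

Lemma ssg_l n i j : i = j -> ssg n i j = sg n.+1 j.+1 * sg n.+1 j.
Proof. by rewrite /ssg => ->; rewrite ltnn eqxx. Qed.

Lemma ssg_r n i j : i = j.+1 -> ssg n i j = sg n.+1 j * sg n.+1 j.+1.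
Proof.
by rewrite /ssg => ->; rewrite eqxx (ltnNge j.+1) leqnSn [_ == j]eqn_leq ltnn.
Qed.

Lemma ssg_gt n i j : j.+1 < i -> ssg n i j = sg n.+1 j.
Proof.
move=> ji; rewrite /ssg ltnNge (ltnW (ltnW ji)) /= !gtn_eqF //.
exact: ltnW.
Qed.

Ltac eval_tpn :=
  repeat match goal with
  | |- context [tpn ?j ?i] =>
      first [ rewrite (@tpn_l j i); [|lia] | rewrite (@tpn_r j i); [|lia]
            | rewrite (@tpn_n j i); [|lia|lia] ]
  end.

Ltac eval_ssg :=
  eval_tpn;
  repeat match goal with
  | |- context [ssg ?n ?i ?j] =>
      first [ rewrite (@ssg_lt n i j); [|lia] | rewrite (@ssg_l n i j); [|lia]
            | rewrite (@ssg_r n i j); [|lia] | rewrite (@ssg_gt n i j); [|lia] ]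
  end.

Lemma far3 n i j k : i.+1 < k -> j.+1 < k ->
  sg n i * sg n j * sg n k = sg n k * (sg n i * sg n j).
Proof. by move=> ik jk; rewrite -mulgA (sg_far _ jk) mulgA (sg_far _ ik) mulgA. Qed.

Lemma far3' n i j k : i.+1 < j -> i.+1 < k ->
  sg n i * (sg n j * sg n k) = sg n j * sg n k * sg n i.
Proof. by move=> ij ik; rewrite mulgA (sg_far _ ij) -mulgA (sg_far _ ik) mulgA. Qed.

Lemma ssg_far n i j k : j.+1 < k ->
  ssg n i j * ssg n (tpn j i) k = ssg n i k * ssg n (tpn k i) j.
Proof.
move=> jk.
have [lt_ij|[ij|[ij|gt_ij]]] : i < j \/ i = j \/ i = j.+1 \/ j.+1 < i by lia.
- by eval_ssg; rewrite sg_far.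
- by eval_ssg; rewrite far3 //; lia.
- by eval_ssg; rewrite far3 //; lia.
have [lt_ik|[ik|[ik|gt_ik]]] : i < k \/ i = k \/ i = k.+1 \/ k.+1 < i by lia.
- by eval_ssg; rewrite sg_far //; lia.
- by eval_ssg; rewrite far3' //; lia.
- by eval_ssg; rewrite far3' //; lia.
- by eval_ssg; rewrite sg_far.
Qed.

Lemma braid_w2 n j : j.+3 < n ->
  let a := sg n j in let b := sg n j.+1 in let c := sg n j.+2 in
  (b * a) * (c * b) * a = c * (b * a) * (c * b).
Proof.
move=> lt_j a b c.
have ac : a * c = c * a by apply: sg_far.
have aba : a * b * a = b * a * b by apply: sg_adj; lia.
have bcb : b * c * b = c * b * c by apply: sg_adj; lia.
transitivity (b * c * (a * b * a)).
  by rewrite !mulgA -(mulgA b a c) ac !mulgA.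
rewrite aba !mulgA bcb.
by rewrite -(mulgA _ c a) -ac !mulgA.
Qed.

Lemma braid_w3 n j : j.+3 < n ->
  let a := sg n j in let b := sg n j.+1 in let c := sg n j.+2 in
  (a * b) * c * (b * a) = (c * b) * a * (b * c).
Proof.
move=> lt_j a b c.
have ac : a * c = c * a by apply: sg_far.
have aba : a * b * a = b * a * b by apply: sg_adj; lia.
have bcb : b * c * b = c * b * c by apply: sg_adj; lia.
transitivity (a * (b * c * b) * a); first by rewrite !mulgA.
rewrite bcb; transitivity (c * (a * b * a) * c).
  by rewrite !mulgA ac -!mulgA ac !mulgA.
by rewrite aba !mulgA.
Qed.

Lemma braid_w4 n j : j.+3 < n ->
  let a := sg n j in let b := sg n j.+1 in let c := sg n j.+2 in
  a * (b * c) * (a * b) = (b * c) * (a * b) * c.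
Proof.
move=> lt_j a b c.
have ac : a * c = c * a by apply: sg_far.
have aba : a * b * a = b * a * b by apply: sg_adj; lia.
have bcb : b * c * b = c * b * c by apply: sg_adj; lia.
transitivity (a * b * a * c * b).
  by rewrite -(mulgA (a * b)) ac !mulgA.
rewrite aba -!mulgA [b * (c * b)]mulgA bcb [RHS]mulgA.
by rewrite -!mulgA [a * (c * _)]mulgA ac !mulgA.
Qed.

Lemma ssg_adj n i j : j.+2 < n ->
  ssg n i j * ssg n (tpn j i) j.+1 * ssg n (tpn j.+1 (tpn j i)) j
  = ssg n i j.+1 * ssg n (tpn j.+1 i) j * ssg n (tpn j (tpn j.+1 i)) j.+1.
Proof.
move=> lt_j.
have [?|[?|[?|[?|?]]]] :
  i < j \/ i = j \/ i = j.+1 \/ i = j.+2 \/ j.+2 < i by lia.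
- by eval_ssg; apply: sg_adj; lia.
- by eval_ssg; apply: braid_w2; lia.
- by eval_ssg; apply: braid_w3; lia.
- by eval_ssg; apply: braid_w4; lia.
- by eval_ssg; apply: sg_adj; lia.
Qed.

Lemma tpn_far j k i : j.+1 < k -> tpn k (tpn j i) = tpn j (tpn k i).
Proof.
move=> jk; have [?|[?|[?|[?|?]]]] : i = j \/ i = j.+1 \/ i = k \/ i = k.+1 \/
  (i <> j /\ i <> j.+1 /\ i <> k /\ i <> k.+1) by lia.
all: by eval_tpn.
Qed.

Lemma tpn_adj j i :
  tpn j (tpn j.+1 (tpn j i)) = tpn j.+1 (tpn j (tpn j.+1 i)).
Proof.
have [?|[?|[?|?]]] : i = j \/ i = j.+1 \/ i = j.+2 \/
  (i <> j /\ i <> j.+1 /\ i <> j.+2) by lia.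
all: by eval_tpn.
Qed.

Section SplitWord.

Variable n : nat.

Implicit Types (u v w : seq ('I_n.-1 * bool)) (i : 'I_n).

Lemma word_perm_cat u v : word_perm (u ++ v) = word_perm u * word_perm v.
Proof. exact: big_cat. Qed.

Lemma word_perm_cons l w : word_perm (l :: w) = letter_perm l * word_perm w.
Proof. exact: big_cons. Qed.

Lemma word_perm_nil : word_perm [::] = 1 :> 'S_n.
Proof. exact: big_nil. Qed.

Lemma letter_permK l i : letter_perm l (letter_perm l i) = i.
Proof. exact: tpermK. Qed.

Lemma split_word_cat i u v :
  split_word i (u ++ v) = split_word i u * split_word (word_perm u i) v.
Proof.
elim: u i => [|l u IH] i /=; first by rewrite mul1g word_perm_nil perm1.
by rewrite IH mulgA word_perm_cons permM.
Qed.

Lemma artin_rel_split u v : artin_rel u v ->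
  word_perm u = word_perm v /\ forall i, split_word i u = split_word i v.
Proof.
have far (j k : 'I_n.-1) : j.+1 < k ->
  let u := [:: (j, false); (k, false)] in
  let v := [:: (k, false); (j, false)] in
  word_perm u = word_perm v /\ forall i, split_word i u = split_word i v.
  move=> jk; split=> [|i] /=.
    apply/permP => i; rewrite !word_perm_cons !word_perm_nil !permM !perm1.
    by apply/val_inj; rewrite /= !letter_permE /= tpn_far.
  rewrite !mulg1 /split_letter /= !split_sigmaE !letter_permE.
  exact: ssg_far.
have adj (j k : 'I_n.-1) : j.+1 == k ->
  let u := [:: (j, false); (k, false); (j, false)] in
  let v := [:: (k, false); (j, false); (k, false)] in
  word_perm u = word_perm v /\ forall i, split_word i u = split_word i v.
  move=> /eqP jk; split=> [|i] /=.
    apply/permP => i; rewrite !word_perm_cons !word_perm_nil !permM !perm1.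
    by apply/val_inj; rewrite /= !letter_permE /= -jk tpn_adj.
  rewrite !mulg1 /split_letter /= !split_sigmaE !letter_permE /= -jk.
  by rewrite !mulgA; apply: ssg_adj; have := ltn_ord k; lia.
case=> j k /orP[] jk.
- exact: far.
- by have [-> sE] := far _ _ jk; split=> // i; rewrite sE.
- exact: adj.
- by have [-> sE] := adj _ _ jk; split=> // i; rewrite sE.
Qed.

Lemma pres_eq_split u v : pres_eq (@artin_rel n) u v ->
  word_perm u = word_perm v /\ forall i, split_word i u = split_word i v.
Proof.
elim=> {u v} [u|u v _ [-> uv]|u v w _ [-> uv] _ [-> vw]|u u' v v'|j e|u v].
- by [].
- by split=> // i; rewrite uv.
- by split=> // i; rewrite uv vw.
- move=> _ [uE uu] _ [vE vv]; split; first by rewrite !word_perm_cat uE vE.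
  by move=> i; rewrite !split_word_cat uu vv uE.
- have lpN e' : letter_perm (j, ~~ e') = letter_perm (j, e') :> 'S_n by [].
  split.
    rewrite !word_perm_cons word_perm_nil mulg1 lpN.
    by apply/permP => i; rewrite permM letter_permK perm1.
  move=> i /=; rewrite mulg1 /split_letter /=.
  case: e => /=; first by rewrite -/(letter_perm (j, true)) mulVg.
  by rewrite letter_permK mulgV.
- exact: artin_rel_split.
Qed.

Local Notation wc := (word_class (@artin_rel n)).

Lemma pres_eq_repr w : pres_eq (@artin_rel n) (repr (wc w)) w.
Proof. by apply/word_classP; rewrite word_class_repr. Qed.

Lemma braid_perm_word w : braid_perm (wc w) = word_perm w.
Proof. by have [] := pres_eq_split (pres_eq_repr w). Qed.

Lemma split_wordE i w : split i (wc w) = split_word i w.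
Proof. by have [_] := pres_eq_split (pres_eq_repr w); apply. Qed.

Lemma braid_perm_is_morph : {morph @braid_perm n : a b / a * b >-> a * b}.
Proof.
elim/pres_ind=> u; elim/pres_ind=> v.
by rewrite -word_class_cat !braid_perm_word word_perm_cat.
Qed.

HB.instance Definition _ := isMultiplicative.Build (braid n) 'S_n
  (@braid_perm n) braid_perm_is_morph.

Lemma braid_perm1 : braid_perm (1 : braid n) = 1.
Proof. by rewrite braid_perm_word word_perm_nil. Qed.

HB.instance Definition _ := Multiplicative_isUMagmaMorphism.Build (braid n) 'S_n
  (@braid_perm n) braid_perm1.

Lemma braid_permM (a b : braid n) :
  braid_perm (a * b) = braid_perm a * braid_perm b.
Proof. exact: braid_perm_is_morph. Qed.

Lemma braid_permV (a : braid n) : braid_perm a^-1 = (braid_perm a)^-1.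
Proof. exact: gmulfV. Qed.

Lemma braid_perm_sigma (j : 'I_n.-1) : braid_perm (sigma j) = tperm (lpos j) (rpos j).
Proof. by rewrite braid_perm_word word_perm_cons word_perm_nil mulg1. Qed.

Lemma split1 i : split i 1 = 1.
Proof. by rewrite split_wordE. Qed.

Lemma splitM i (a b : braid n) :
  split i (a * b) = split i a * split (braid_perm a i) b.
Proof.
elim/pres_ind: a => u; elim/pres_ind: b => v.
by rewrite -word_class_cat !split_wordE braid_perm_word split_word_cat.
Qed.

Lemma splitV i (a : braid n) :
  split i a^-1 = (split ((braid_perm a)^-1 i) a)^-1.
Proof.
apply: (mulgI (split ((braid_perm a)^-1 i) a)).
by rewrite mulgV -[X in _ * split X _](permKV (braid_perm a)) -splitM mulgV split1.
Qed.

Lemma split_sigmaP i (j : 'I_n.-1) : split i (sigma j) = split_sigma i j.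
Proof. by rewrite split_wordE /= mulg1. Qed.

Lemma braid_ind (P : braid n -> Prop) :
  P 1 -> (forall j, P (sigma j)) -> (forall a b, P a -> P b -> P (a * b)) ->
  (forall a, P a -> P a^-1) -> forall a, P a.
Proof.
move=> P1 Ps PM PV; elim/pres_ind; elim=> [|[j e] w IH] //.
rewrite -cat1s word_class_cat; apply: PM => //.
by rewrite word_class_letter; case: e; [apply: PV|]; apply: Ps.
Qed.

End SplitWord.

(* Splitting the strand at position i puts its two copies at the positions i
   and i + 1; any other position k becomes lift (lcopy i) k. *)
Definition lcopy n (i : 'I_n) : 'I_n.+1 := widen_ord (leqnSn n) i.

Definition split_perm n (i : 'I_n) (s : 'S_n) : 'S_n.+1 :=
  lift_perm (lcopy i) (lcopy (s i)) s.

Lemma bump_ge h k : h <= k -> bump h k = k.+1.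
Proof. by rewrite /bump => ->. Qed.

Lemma bump_lt h k : k < h -> bump h k = k.
Proof. by move=> kh; rewrite /bump (leqNgt h) kh. Qed.

Ltac eval_bump :=
  eval_tpn;
  repeat match goal with
  | |- context [bump ?h ?k] =>
      first [ rewrite (@bump_ge h k); [|lia] | rewrite (@bump_lt h k); [|lia] ]
  end; eval_tpn.

Lemma sg_perm n k (x : 'I_n) : k.+1 < n -> braid_perm (sg n k) x = tpn k x :> nat.
Proof.
move=> lt_k; have lt_k' : k < n.-1 by lia.
rewrite /sg insubT braid_perm_sigma.
exact: (letter_permE (Ordinal lt_k', false)).
Qed.

Lemma split_sg n k (x : 'I_n) : k.+1 < n -> split x (sg n k) = ssg n x k.
Proof.
move=> lt_k; have lt_k' : k < n.-1 by lia.
by rewrite /sg insubT split_sigmaP split_sigmaE.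
Qed.

Lemma ssg_perm n i j (x : 'I_n.+1) : i < n -> j.+1 < n ->
  braid_perm (ssg n i j) x =
  (if i < j then tpn j.+1 x
   else if i == j then tpn j (tpn j.+1 x)
   else if i == j.+1 then tpn j.+1 (tpn j x)
   else tpn j x) :> nat.
Proof.
move=> lt_i lt_j; rewrite /ssg.
case: ifP => _; first by rewrite sg_perm.
case: ifP => _; first by rewrite braid_permM permM !sg_perm //; lia.
by case: ifP => _; rewrite ?braid_permM ?permM !sg_perm //; lia.
Qed.

Lemma cases4 (i k : nat) : [\/ i < k, i = k, i = k.+1 | k.+1 < i].
Proof.
have [|[|[|]]] : i < k \/ i = k \/ i = k.+1 \/ k.+1 < i by lia.
all: by [constructor 1|constructor 2|constructor 3|constructor 4].
Qed.

Lemma ssg_perm_lcopy n i j (x : 'I_n.+1) : i < n -> j.+1 < n -> x = i :> nat ->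
  braid_perm (ssg n i j) x = tpn j i :> nat.
Proof.
move=> lt_i lt_j xi; rewrite ssg_perm // xi.
case: (cases4 i j) => ij.
- by rewrite ij; eval_tpn.
- by rewrite ltnNge eq_leq ?ij ?eqxx //=; eval_tpn.
- by rewrite ij ltnNge leqnSn /= gtn_eqF ?eqxx //; eval_tpn.
- by rewrite ltnNge (ltnW (ltnW ij)) /= !gtn_eqF //; lia.
Qed.

Lemma ssg_perm_lift n i j y (x : 'I_n.+1) : i < n -> j.+1 < n ->
  x = bump i y :> nat ->
  braid_perm (ssg n i j) x = bump (tpn j i) (tpn j y) :> nat.
Proof.
move=> lt_i lt_j xi; rewrite ssg_perm // xi.
case: (cases4 i j) => ij.
- by rewrite ij; case: (cases4 y j) => ?; have [?|?] := leqP i y; eval_bump; lia.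
- rewrite ltnNge eq_leq ?ij ?eqxx //=.
  by case: (cases4 y j) => ?; eval_bump; lia.
- rewrite ij ltnNge leqnSn /= gtn_eqF ?eqxx //.
  by case: (cases4 y j) => ?; eval_bump; lia.
- rewrite ltnNge (ltnW (ltnW ij)) /= !gtn_eqF //; last lia.
  by case: (cases4 y j) => ?; have [?|?] := leqP i y; eval_bump; lia.
Qed.

Lemma split_perm1 n (i : 'I_n) : split_perm i 1 = 1.
Proof. by rewrite /split_perm perm1 lift_perm1. Qed.

Lemma split_permM n (i : 'I_n) (s t : 'S_n) :
  split_perm i (s * t) = split_perm i s * split_perm (s i) t.
Proof. by rewrite /split_perm permM lift_permM. Qed.

Lemma braid_perm_split n (i : 'I_n) (b : braid n) :
  braid_perm (split i b) = split_perm i (braid_perm b).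
Proof.
elim/braid_ind: b i => [|j|a b IHa IHb|a IH] i.
- by rewrite split1 !braid_perm1 split_perm1.
- rewrite split_sigmaP split_sigmaE.
  have lt_j := rpos_subproof j.
  have sE (y : 'I_n) : braid_perm (sigma j) y = tpn j y :> nat.
    by rewrite -sgE sg_perm.
  apply/permP => x; apply/val_inj => /=.
  case: (unliftP (lcopy i) x) => [y|] xE; rewrite /split_perm xE.
    by rewrite lift_perm_lift (@ssg_perm_lift _ _ _ y) //= !sE.
  by rewrite lift_perm_id ssg_perm_lcopy //= sE.
- by rewrite splitM !braid_permM IHa IHb split_permM.
- rewrite splitV !braid_permV IH /split_perm lift_permV permKV.
  by rewrite permE.
Qed.

Lemma bump_swap i j : i <> j -> bump (bump i j) i = bump j i.
Proof. by rewrite /bump => ?; lia. Qed.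

Lemma bump2C i j k : i <> j ->
  bump (bump i j) (bump i k) = bump (bump j i) (bump j k).
Proof. by rewrite /bump => ?; lia. Qed.

Lemma split_perm_lcopy n (i : 'I_n) (s : 'S_n) :
  split_perm i s (lcopy i) = lcopy (s i).
Proof. exact: lift_perm_id. Qed.

Lemma split_perm_lift n (i j : 'I_n) (s : 'S_n) :
  split_perm i s (lift (lcopy i) j) = lift (lcopy (s i)) (s j).
Proof. exact: lift_perm_lift. Qed.

Lemma lift_swap n (i j : 'I_n) : i != j ->
  lift (lcopy (lift (lcopy i) j)) (lcopy i) = lcopy (lift (lcopy j) i).
Proof. by move=> /eqP ij; apply/val_inj/(@bump_swap i j) => /ord_inj. Qed.

Lemma lift2C n (i j k : 'I_n) : i != j ->
  lift (lcopy (lift (lcopy i) j)) (lift (lcopy i) k)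
  = lift (lcopy (lift (lcopy j) i)) (lift (lcopy j) k).
Proof. by move=> /eqP ij; apply/val_inj/(@bump2C i j k) => /ord_inj. Qed.

Lemma split_permC n (i j : 'I_n) (s : 'S_n) : i != j ->
  split_perm (lift (lcopy i) j) (split_perm i s)
  = split_perm (lift (lcopy j) i) (split_perm j s).
Proof.
move=> ij; have ji : j != i by rewrite eq_sym.
have sij : s i != s j by rewrite (inj_eq perm_inj).
have sji : s j != s i by rewrite eq_sym.
apply/permP => x.
case: (unliftP (lcopy (lift (lcopy i) j)) x) => [y|] ->.
  case: (unliftP (lcopy i) y) => [k|] ->.
    by rewrite split_perm_lift lift2C // !split_perm_lift lift2C.
  rewrite split_perm_lift lift_swap // !split_perm_lcopy !split_perm_lift.
  by rewrite lift_swap.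
rewrite -lift_swap // split_perm_lift [in LHS]lift_swap // !split_perm_lcopy.
by rewrite !split_perm_lift lift_swap.
Qed.

Lemma splitC_sigma n i j k (x y : 'I_n.+1) :
  i < n -> j < n -> k.+1 < n -> i < j -> x = bump i j :> nat -> y = bump j i :> nat ->
  split x (ssg n i k) = split y (ssg n j k).
Proof.
move=> lt_i lt_j lt_k lt_ij xE yE.
rewrite bump_ge ?(ltnW lt_ij) // in xE; rewrite bump_lt // in yE.
have split_sg2 (z : 'I_n.+1) l m : l.+1 < n.+1 -> m.+1 < n.+1 ->
    split z (sg n.+1 l * sg n.+1 m) = ssg n.+1 z l * ssg n.+1 (tpn l z) m.
  by move=> lt_l lt_m; rewrite splitM !split_sg // sg_perm.
have lt_k1 : k.+2 < n.+1 by lia.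
have lt_k0 : k.+1 < n.+1 by lia.
case: (cases4 i k) => ik; case: (cases4 j k) => jk; try lia; eval_ssg;
  rewrite ?split_sg2 ?split_sg // xE yE.
all: eval_ssg => //.
by rewrite !mulgA -(mulgA _ _ (sg _ k)) -(@sg_far _ k k.+2) // mulgA.
Qed.

Lemma splitC n (i j : 'I_n) (b : braid n) : i != j ->
  split (lift (lcopy i) j) (split i b) = split (lift (lcopy j) i) (split j b).
Proof.
elim/braid_ind: b i j => [|k|a b IHa IHb|a IH] i j ij.
- by rewrite !split1.
- rewrite !split_sigmaP !split_sigmaE.
  have lt_k := rpos_subproof k.
  have [lt_ij|lt_ji|/ord_inj/eqP] := ltngtP i j; last by rewrite (negPf ij).
    exact: splitC_sigma.
  by symmetry; apply: splitC_sigma.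
- rewrite !splitM !braid_perm_split !split_perm_lift IHa // IHb //.
  by rewrite (inj_eq perm_inj).
- rewrite !splitV !braid_perm_split.
  set s := braid_perm a.
  have sV (k l : 'I_n) :
      (split_perm (s^-1 k) s)^-1 (lift (lcopy k) l)
      = lift (lcopy (s^-1 k)) (s^-1 l).
    by apply: (perm_inj (s := split_perm (s^-1 k) s));
       rewrite permKV split_perm_lift !permKV.
  by rewrite !sV IH // (inj_eq perm_inj).
Qed.

(* The data from which BV and V are built in the same way: groups with a
   projection to the symmetric groups and a strand splitting operation. *)
Record cloning_system := CloningSystem {
  cgroup :> nat -> groupType;
  cperm : forall n, cgroup n -> 'S_n;
  csplit : forall n, 'I_n -> cgroup n -> cgroup n.+1;
  cpermM : forall n (a b : cgroup n), cperm (a * b) = cperm a * cperm b;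
  csplitM : forall n (i : 'I_n) (a b : cgroup n),
    csplit i (a * b) = csplit i a * csplit (cperm a i) b;
  cperm_split : forall n (i : 'I_n) (a : cgroup n),
    cperm (csplit i a) = split_perm i (cperm a);
  csplitC : forall n (i j : 'I_n) (a : cgroup n), i != j ->
    csplit (lift (lcopy i) j) (csplit i a)
    = csplit (lift (lcopy j) i) (csplit j a) }.

Definition braid_cloning : cloning_system :=
  CloningSystem braid_permM splitM braid_perm_split splitC.

Definition perm_cloning : cloning_system :=
  @CloningSystem (fun n => 'S_n) (fun n s => s) split_perm
    (fun n s t => erefl) split_permM (fun n i s => erefl) split_permC.

Inductive tree := Leaf | Node of tree & tree.

Fixpoint leaves (T : tree) : nat :=
  if T is Node l r then leaves l + leaves r else 1%N.

(* The leaves are numbered from 0; the value for i >= leaves T is irrelevant. *)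
Fixpoint attach_caret (T : tree) (i : nat) : tree :=
  if T is Node l r then
    if i < leaves l then Node (attach_caret l i) r
    else Node l (attach_caret r (i - leaves l))
  else Node Leaf Leaf.

Lemma leaves_attach T i : leaves (attach_caret T i) = (leaves T).+1.
Proof.
elim: T i => //= l IHl r IHr i.
by case: ifP => _ /=; rewrite ?IHl ?IHr ?addSn ?addnS.
Qed.

Definition ltree n := {T : tree | leaves T == n}.

Lemma ltree_size n m (T : ltree n) (W : ltree m) : val T = val W -> n = m.
Proof. by move=> e; rewrite -(eqP (valP T)) -(eqP (valP W)) e. Qed.

Lemma caret_subproof n (T : ltree n) i : leaves (attach_caret (val T) i) == n.+1.
Proof. by rewrite leaves_attach (eqP (valP T)). Qed.

Definition caret n (T : ltree n) (i : 'I_n) : ltree n.+1 :=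
  exist _ (attach_caret (val T) i) (caret_subproof T i).

Definition leaf : ltree 1%N := exist _ Leaf (eqxx 1%N).

Fixpoint tle (T W : tree) : bool :=
  match T, W with
  | Leaf, _ => true
  | Node l r, Node l' r' => tle l l' && tle r r'
  | _, _ => false
  end.

Fixpoint tjoin (T W : tree) : tree :=
  match T, W with
  | Leaf, _ => W
  | _, Leaf => T
  | Node l r, Node l' r' => Node (tjoin l l') (tjoin r r')
  end.

Lemma leaves_gt0 T : 0 < leaves T.
Proof. by elim: T => //= l IHl r IHr; rewrite addn_gt0 IHl. Qed.

Lemma attach_l l r i : i < leaves l ->
  attach_caret (Node l r) i = Node (attach_caret l i) r.
Proof. by move=> /= ->. Qed.

Lemma attach_r l r i : leaves l <= i ->
  attach_caret (Node l r) i = Node l (attach_caret r (i - leaves l)).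
Proof. by move=> /=; rewrite leqNgt => /negPf->. Qed.

Lemma tle_refl T : tle T T.
Proof. by elim: T => //= l -> r ->. Qed.

Lemma tle_joinl T W : tle T (tjoin T W).
Proof.
elim: T W => [//|l IHl r IHr] [|l' r'] /=; first by rewrite !tle_refl.
by rewrite IHl IHr.
Qed.

Lemma tle_joinr T W : tle W (tjoin T W).
Proof.
elim: T W => [|l IHl r IHr] [|l' r'] //=; first by rewrite !tle_refl.
by rewrite IHl IHr.
Qed.

Lemma tle_trans T U W : tle T U -> tle U W -> tle T W.
Proof.
elim: T U W => [//|l IHl r IHr] [//|l' r'] [//|l'' r''] /=.
by move=> /andP[h1 h2] /andP[h3 h4]; rewrite (IHl l') // (IHr r').
Qed.

Lemma tle_attach T i : tle T (attach_caret T i).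
Proof.
by elim: T i => //= l IHl r IHr i; case: ifP => _ /=; rewrite ?IHl ?IHr !tle_refl.
Qed.

Lemma tle_leaves T W : tle T W -> leaves T <= leaves W.
Proof.
elim: T W => [W _|l IHl r IHr [//|l' r'] /= /andP[h1 h2]].
  exact: leaves_gt0.
by rewrite leq_add ?IHl ?IHr.
Qed.

Lemma tle_eq T W : tle T W -> leaves W <= leaves T -> T = W.
Proof.
elim: T W => [[//|l r] _ /=|l IHl r IHr [//|l' r'] /= /andP[h1 h2] le].
  by have := leaves_gt0 l; have := leaves_gt0 r; lia.
have := tle_leaves h1; have := tle_leaves h2 => g1 g2.
move: le; rewrite /= => le.
have el : leaves l' <= leaves l by lia.
have er : leaves r' <= leaves r by lia.
by rewrite (IHl l' h1 el) (IHr r' h2 er).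
Qed.

Lemma tle_step T W : tle T W -> leaves T < leaves W ->
  exists2 i, i < leaves T & tle (attach_caret T i) W.
Proof.
elim: T W => [[//|l r] _ _|l IHl r IHr [//|l' r']]; first by exists 0.
move=> /= /andP[h1 h2] lt.
have [le_l|/(IHl _ h1)[i lt_i le_i]] := leqP (leaves l') (leaves l).
  have /(IHr _ h2)[i lt_i le_i] : leaves r < leaves r' by lia.
  exists (leaves l + i); first by rewrite ltn_add2l.
  by rewrite ltnNge leq_addr /= h1 addKn.
by exists i; [exact: ltn_addr | rewrite lt_i /= le_i].
Qed.

Lemma attachC T i j : i < leaves T -> j < leaves T -> i <> j ->
  attach_caret (attach_caret T i) (bump i j)
  = attach_caret (attach_caret T j) (bump j i).
Proof.
elim: T i j => [|l IHl r IHr] i j /=; first by lia.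
move=> lt_i lt_j ij.
have [il|il] := ltnP i (leaves l); have [jl|jl] := ltnP j (leaves l).
- have e a b : b < leaves l -> bump a b < (leaves l).+1 by rewrite /bump; lia.
  by rewrite !attach_l ?leaves_attach ?e // (IHl i j).
- rewrite bump_ge; last lia. rewrite bump_lt; last lia.
  by rewrite attach_r ?leaves_attach ?attach_l // subSS.
- rewrite bump_lt; last lia. rewrite bump_ge; last lia.
  by rewrite attach_l // attach_r ?leaves_attach // subSS.
- have e a b : leaves l <= a -> leaves l <= b ->
    bump a b - leaves l = bump (a - leaves l) (b - leaves l).
    by rewrite /bump; lia.
  have g a b : leaves l <= b -> leaves l <= bump a b by rewrite /bump; lia.
  by rewrite !attach_r ?g // !e // (IHr (i - _) (j - _)) //; lia.
Qed.

Lemma tle_attach2 T W i j : i < leaves T -> j < leaves T -> i <> j ->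
  tle (attach_caret T i) W -> tle (attach_caret T j) W ->
  tle (attach_caret (attach_caret T i) (bump i j)) W.
Proof.
elim: T W i j => [|l IHl r IHr] W i j /=; first by lia.
move=> lt_i lt_j ij.
have [il|il] := ltnP i (leaves l); have [jl|jl] := ltnP j (leaves l);
  case: W => // l' r' /= /andP[h1 h2] /andP[h3 h4].
- rewrite leaves_attach [bump i j < _](_ : _ = true) /= ?h2 ?IHl //.
  by rewrite /bump; lia.
- rewrite leaves_attach bump_ge; last lia.
  by rewrite ltnS ltnNge jl /= subSS h1 h4.
- by rewrite bump_lt ?jl /= ?h3 ?h2 //; lia.
- have e a b : leaves l <= a -> leaves l <= b ->
    bump a b - leaves l = bump (a - leaves l) (b - leaves l).
    by rewrite /bump; lia.
  rewrite [bump i j < _](_ : _ = false) /= ?h1 ?e ?IHr //; try lia.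
  by rewrite /bump; lia.
Qed.

Section Thompson.

Variable C : cloning_system.

Record triple := Triple {
  arity : nat;
  src : ltree arity;
  elt : C arity;
  tgt : ltree arity }.

HB.instance Definition _ := gen_eqMixin triple.
HB.instance Definition _ := gen_choiceMixin triple.

Definition expand (x : triple) (i : 'I_(arity x)) : triple :=
  Triple (caret (src x) i) (csplit i (elt x))
         (caret (tgt x) (cperm (elt x) i)).

Arguments expand : clear implicits.

Definition tstep (x y : triple) : Prop := exists i, y = expand x i.

Definition tequiv : triple -> triple -> Prop := clos_refl_sym_trans triple tstep.

Definition tequivb x y : bool := `[< tequiv x y >].

Lemma tequivb_equiv : equiv_class_of tequivb.
Proof.
split=> [x|x y|y x z]; first by apply/asboolP; apply: rst_refl.
  by apply/asboolP/asboolP; apply: rst_sym.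
by move=> /asboolP xy /asboolP yz; apply/asboolP; apply: rst_trans xy yz.
Qed.

Canonical tequiv_equiv := EquivRelPack tequivb_equiv.

Definition thompson := {eq_quot tequiv_equiv}.
HB.instance Definition _ := Choice.on thompson.

Definition triple_class (x : triple) : thompson := \pi x.

Lemma triple_classP x y : triple_class x = triple_class y <-> tequiv x y.
Proof. by split=> [/eqmodP/asboolP|xy]; last apply/eqmodP/asboolP. Qed.

Lemma triple_class_repr X : triple_class (repr X) = X.
Proof. exact: reprK. Qed.

Lemma thompson_ind (P : thompson -> Prop) :
  (forall x, P (triple_class x)) -> forall X, P X.
Proof. by move=> Px X; rewrite -(triple_class_repr X). Qed.

(* tprod x y z: the trees tgt x and src y agree, and z is the product. *)
Inductive tprod : triple -> triple -> triple -> Prop :=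
| TProd n (T U W : ltree n) (a b : C n) :
    tprod (Triple T a U) (Triple U b W) (Triple T (a * b) W).

Lemma csplit1 n (i : 'I_n) : csplit i (1 : C n) = 1.
Proof.
have c1 : cperm (1 : C n) = 1.
  by apply: (mulgI (cperm (1 : C n))); rewrite -cpermM !mulg1.
apply: (mulgI (csplit i (1 : C n))).
by rewrite mulg1 -[X in _ * csplit X _](perm1 i) -c1 -csplitM mulg1.
Qed.

Lemma cperm1 n : cperm (1 : C n) = 1.
Proof. by apply: (mulgI (cperm (1 : C n))); rewrite -cpermM !mulg1. Qed.

Lemma cpermV n (a : C n) : cperm a^-1 = (cperm a)^-1.
Proof. by apply: (mulgI (cperm a)); rewrite -cpermM !mulgV cperm1. Qed.

Lemma csplitV n (i : 'I_n) (a : C n) :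
  csplit (cperm a i) a^-1 = (csplit i a)^-1.
Proof. by apply: (mulgI (csplit i a)); rewrite -csplitM !mulgV csplit1. Qed.

Lemma triple_inj n (T T' U U' : ltree n) (a a' : C n) :
  Triple T a U = Triple T' a' U' -> [/\ T = T', a = a' & U = U'].
Proof.
pose P n := (ltree n * C n * ltree n)%type.
pose f x : {n : nat & P n} := existT P (arity x) (src x, elt x, tgt x).
move=> /(congr1 f) e.
by have [-> -> ->] := eq_from_Tagged (e : Tagged P (T, a, U) = Tagged P (T', a', U')).
Qed.

Definition tsrc x := val (src x).
Definition ttgt x := val (tgt x).

Lemma arity_src x : arity x = leaves (tsrc x).
Proof. by rewrite (eqP (valP (src x))). Qed.

Lemma arity_tgt x : arity x = leaves (ttgt x).
Proof. by rewrite (eqP (valP (tgt x))). Qed.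

Definition tinv x := Triple (tgt x) (elt x)^-1 (src x).

Lemma tinvK : involutive tinv.
Proof. by case=> n T a U; rewrite /tinv /= invgK. Qed.

Lemma tstep_inv x y : tstep x y -> tstep (tinv x) (tinv y).
Proof.
case: x => n T a U [i ->] /=; exists (cperm a i); rewrite /tinv /expand /=.
by rewrite csplitV cpermV permK.
Qed.

Definition reach := clos_refl_trans_1n triple tstep.

Lemma reach_trans x y z : reach x y -> reach y z -> reach x z.
Proof. by elim=> // x' y' z' xy _ IH /IH; apply: rt1n_trans xy. Qed.

Lemma reach_inv x y : reach x y -> reach (tinv x) (tinv y).
Proof.
elim=> [x'|x' y' z' /tstep_inv xy _]; first exact: rt1n_refl.
exact: rt1n_trans.
Qed.

Lemma tstep_diamond x y1 y2 : tstep x y1 -> tstep x y2 -> y1 = y2 \/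
  exists z, [/\ tstep y1 z, tstep y2 z &
    forall W, tle (tsrc y1) W -> tle (tsrc y2) W -> tle (tsrc z) W].
Proof.
case: x => n T a U [i ->] [j ->] /=; have [->|ij] := eqVneq i j; [by left|right].
rewrite /= in i j ij *.
have eT := eqP (valP T); have eU := eqP (valP U).
have nij : (i : nat) <> j by move/ord_inj/eqP; rewrite (negPf ij).
have nsij : (cperm a i : nat) <> cperm a j.
  by move/ord_inj/perm_inj/eqP; rewrite (negPf ij).
exists (@expand (@expand (Triple T a U) i) (lift (lcopy i) j)); split.
- by eexists.
- exists (lift (lcopy j) i); rewrite /expand /=.
  rewrite csplitC // !cperm_split !split_perm_lift.
  congr Triple; apply/val_inj => /=; apply: attachC => //;
    by rewrite ?eT ?eU.
- by move=> W h1 h2; apply: tle_attach2; rewrite ?eT.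
Qed.

Lemma tstep_arity x y : tstep x y -> arity y = (arity x).+1.
Proof. by case=> i ->. Qed.

Lemma tstep_tle x y : tstep x y -> tle (tsrc x) (tsrc y).
Proof. by case=> i ->; apply: tle_attach. Qed.

Lemma reach_tle x y : reach x y -> tle (tsrc x) (tsrc y).
Proof.
elim=> [z|x' y' z' /tstep_tle xy _]; [exact: tle_refl | exact: tle_trans].
Qed.

Lemma reach_to x W : tle (tsrc x) W -> exists2 y, reach x y & tsrc y = W.
Proof.
move: {2}(leaves W - arity x) (erefl (leaves W - arity x)) => k.
elim: k x => [|k IH] x kE xW.
  exists x; first exact: rt1n_refl.
  by apply: tle_eq => //; rewrite -arity_src; lia.
have /(tle_step xW) [i] : leaves (tsrc x) < leaves W by rewrite -arity_src; lia.
rewrite -arity_src => lt_i iW.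
have [||y xy yW] := IH (expand x (Ordinal lt_i)) => //; first by rewrite /=; lia.
by exists y => //; apply: rt1n_trans xy; exists (Ordinal lt_i).
Qed.

Lemma reach_to_r x W : tle (ttgt x) W -> exists2 y, reach x y & ttgt y = W.
Proof.
move=> xW; have [y xy yW] := @reach_to (tinv x) W xW.
by exists (tinv y); rewrite // -(tinvK x); apply: reach_inv.
Qed.

Lemma reach_arity x y : reach x y -> y = x \/ arity x < arity y.
Proof.
elim=> [z|x' y' z' /tstep_arity e _ [->|lt]]; [by left|right|right].
  by rewrite e.
by rewrite (leq_trans _ lt) // e leqW.
Qed.

Lemma reach_det x w w' : reach x w -> reach x w' -> tsrc w = tsrc w' -> w = w'.
Proof.
move: {2}(arity w - arity x) (erefl (arity w - arity x)) => k.
elim: k x w w' => [|k IH] x w w' kE xw xw' ww'.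
  have aw : arity w = arity w' by rewrite !arity_src ww'.
  case: (reach_arity xw) => [->|]; last by lia.
  by case: (reach_arity xw') => [->|] //; lia.
have aw : arity w = arity w' by rewrite !arity_src ww'.
case: xw kE aw ww' => [|y1 w1 s1 r1] kE aw ww'; first by lia.
case: xw' aw ww' => [|y2 w2 s2 r2] aw ww'; first by lia.
have a1 := tstep_arity s1; have a2 := tstep_arity s2.
case: (tstep_diamond s1 s2) => [e|[z [s3 s4 zP]]].
  by rewrite -e in r2; apply: (IH y1) => //; lia.
have zW : tle (tsrc z) (tsrc w1).
  by apply: zP; [|rewrite ww']; apply: reach_tle.
have [w3 r3 w3E] := reach_to zW.
have e1 : w1 = w3.
  by apply: (IH y1) => //; [lia | apply: rt1n_trans r3].
rewrite e1; symmetry; apply: (IH y2) => //; first by rewrite -aw; lia.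
  by apply: rt1n_trans r3.
by rewrite w3E.
Qed.

Lemma reach_det_r x w w' : reach x w -> reach x w' -> ttgt w = ttgt w' -> w = w'.
Proof.
move=> /reach_inv xw /reach_inv xw' e.
by rewrite -(tinvK w) (reach_det xw xw' e) tinvK.
Qed.

Lemma reach_confl x y1 y2 : reach x y1 -> reach x y2 ->
  exists2 z, reach y1 z & reach y2 z.
Proof.
move=> r1 r2.
have [z1 rz1 z1E] := reach_to (tle_joinl (tsrc y1) (tsrc y2)).
have [z2 rz2 z2E] := reach_to (tle_joinr (tsrc y1) (tsrc y2)).
exists z1 => //; rewrite (@reach_det x z1 z2) ?z2E //; exact: reach_trans rz1 || exact: reach_trans rz2.
Qed.

Lemma reach_tequiv x y : reach x y -> tequiv x y.
Proof.
elim=> [z|x' y' z' xy _]; first exact: rst_refl.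
by apply: rst_trans; apply: rst_step.
Qed.

Lemma tequivP x y : tequiv x y <-> exists2 z, reach x z & reach y z.
Proof.
split=> [|[z /reach_tequiv xz /reach_tequiv yz]]; last first.
  exact: rst_trans xz (rst_sym _ _ _ _ yz).
elim=> {x y} [x y xy|x|x y _ [z xz yz]|x y z _ [u xu yu] _ [v yv zv]].
- by exists y; [apply: rt1n_trans xy _|]; apply: rt1n_refl.
- by exists x; apply: rt1n_refl.
- by exists z.
- have [w uw vw] := reach_confl yu yv.
  by exists w; [apply: reach_trans uw | apply: reach_trans vw].
Qed.

Lemma tprod_step_l x y z x' : tprod x y z -> tstep x x' ->
  exists y' z', [/\ tstep y y', tstep z z' & tprod x' y' z'].
Proof.
case=> n T U W a b [/= i ->].
exists (@expand (Triple U b W) (cperm a i)), (@expand (Triple T (a * b) W) i).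
split; try by eexists.
by rewrite /expand /= csplitM cpermM permM; apply: TProd.
Qed.

Lemma tprod_step_r x y z y' : tprod x y z -> tstep y y' ->
  exists x' z', [/\ tstep x x', tstep z z' & tprod x' y' z'].
Proof.
case=> n T U W a b [/= i ->]; pose j := (cperm a)^-1 i.
exists (@expand (Triple T a U) j), (@expand (Triple T (a * b) W) j).
split; try by eexists.
by rewrite /expand /= csplitM cpermM permM permKV; apply: TProd.
Qed.

Lemma tprod_step_p x y z z' : tprod x y z -> tstep z z' ->
  exists x' y', [/\ tstep x x', tstep y y' & tprod x' y' z'].
Proof.
case=> n T U W a b [/= i ->].
exists (@expand (Triple T a U) i), (@expand (Triple U b W) (cperm a i)).
split; try by eexists.
by rewrite /expand /= csplitM cpermM permM; apply: TProd.
Qed.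

Lemma tprod_reach_l x y z x' : tprod x y z -> reach x x' ->
  exists y' z', [/\ reach y y', reach z z' & tprod x' y' z'].
Proof.
move=> p r; elim: r y z p => {x x'} [x|x x1 x' s _ IH] y z p.
  by exists y, z; split=> //; apply: rt1n_refl.
have [y1 [z1 [sy sz /IH[y2 [z2 [ry rz q]]]]]] := tprod_step_l p s.
by exists y2, z2; split=> //; [apply: rt1n_trans ry|apply: rt1n_trans rz].
Qed.

Lemma tprod_reach_r x y z y' : tprod x y z -> reach y y' ->
  exists x' z', [/\ reach x x', reach z z' & tprod x' y' z'].
Proof.
move=> p r; elim: r x z p => {y y'} [y|y y1 y' s _ IH] x z p.
  by exists x, z; split=> //; apply: rt1n_refl.
have [x1 [z1 [sx sz /IH[x2 [z2 [rx rz q]]]]]] := tprod_step_r p s.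
by exists x2, z2; split=> //; [apply: rt1n_trans rx|apply: rt1n_trans rz].
Qed.

Lemma tprod_reach_p x y z z' : tprod x y z -> reach z z' ->
  exists x' y', [/\ reach x x', reach y y' & tprod x' y' z'].
Proof.
move=> p r; elim: r x y p => {z z'} [z|z z1 z' s _ IH] x y p.
  by exists x, y; split=> //; apply: rt1n_refl.
have [x1 [y1 [sx sy /IH[x2 [y2 [rx ry q]]]]]] := tprod_step_p p s.
by exists x2, y2; split=> //; [apply: rt1n_trans rx|apply: rt1n_trans ry].
Qed.

Lemma tprod_inv n (T U : ltree n) (a : C n) y z : tprod (Triple T a U) y z ->
  exists W b, y = Triple U b W /\ z = Triple T (a * b) W.
Proof.
move xE : (Triple T a U) => x p; case: p xE => m T' U' W b c xE.
have nm : n = m by have := congr1 arity xE.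
by case: _ / nm T' U' W b c xE => T' U' W b c /triple_inj[-> -> ->]; exists W, c.
Qed.

Lemma tprod_fun x y z z' : tprod x y z -> tprod x y z' -> z = z'.
Proof.
by case=> n T U W a b /tprod_inv[W' [c [/triple_inj[_ -> ->] ->]]].
Qed.

Lemma tprod_src x y z : tprod x y z -> ttgt x = tsrc y.
Proof. by case. Qed.

Lemma tprod_match x y : ttgt x = tsrc y -> exists z, tprod x y z.
Proof.
case: x y => n T a U [m U' b W]; rewrite /ttgt /tsrc /= => e.
have nm : m = n := ltree_size (esym e).
case: _ / (esym nm) U' b W e => U' b W /val_inj <-.
by exists (Triple T (a * b) W); apply: TProd.
Qed.

Lemma tprod_total x y : exists x' y' z, [/\ reach x x', reach y y' & tprod x' y' z].
Proof.
have [x' xx' x'E] := reach_to_r (tle_joinl (ttgt x) (tsrc y)).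
have [y' yy' y'E] := reach_to (tle_joinr (ttgt x) (tsrc y)).
have [|z p] := @tprod_match x' y'; first by rewrite x'E y'E.
by exists x', y', z.
Qed.

Lemma tprod_equiv x y z x1 y1 z1 : tprod x y z -> tprod x1 y1 z1 ->
  tequiv x x1 -> tequiv y y1 -> tequiv z z1.
Proof.
move=> p p1 /tequivP[x2 r r1] yy1.
have [y' [z' [ry rz q]]] := tprod_reach_l p r.
have [y1' [z1' [ry1 rz1 q1]]] := tprod_reach_l p1 r1.
have /tequivP[w yw y1w] : tequiv y' y1'.
  apply: rst_trans (rst_sym _ _ _ _ (reach_tequiv ry)) _.
  exact: rst_trans yy1 (reach_tequiv ry1).
have [x3 [z2 [rx3 rz2 q2]]] := tprod_reach_r q yw.
have [x4 [z3 [rx4 rz3 q3]]] := tprod_reach_r q1 y1w.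
have e : x4 = x3.
  by apply: (reach_det_r rx4 rx3); rewrite (tprod_src q2) (tprod_src q3).
rewrite e in q3; have e' := tprod_fun q2 q3.
apply/tequivP; exists z2; first exact: reach_trans rz rz2.
by rewrite e'; apply: reach_trans rz1 rz3.
Qed.

Lemma thompson_mul_subproof (X Y : thompson) : exists z, exists x y,
  [/\ triple_class x = X, triple_class y = Y & tprod x y z].
Proof.
have [x [y [z [rx ry p]]]] := tprod_total (repr X) (repr Y).
exists z, x, y; split=> //; rewrite -[RHS]triple_class_repr;
  by apply/triple_classP/rst_sym/reach_tequiv.
Qed.

(* [cid] chooses representatives with matching trees; by thompson_mulE below the
   class of their product does not depend on the choice. *)
Definition thompson_mul (X Y : thompson) : thompson :=
  triple_class (sval (cid (thompson_mul_subproof X Y))).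

Lemma thompson_mulE x y z : tprod x y z ->
  thompson_mul (triple_class x) (triple_class y) = triple_class z.
Proof.
move=> p; rewrite /thompson_mul; case: cid => z' [x' [y' [ex ey q]]] /=.
by apply/triple_classP; apply: (tprod_equiv q p); apply/triple_classP.
Qed.

Definition thompson_one : thompson := triple_class (Triple leaf 1 leaf).

Lemma reach_id x y : reach x y ->
  (exists n (T : ltree n), x = Triple T 1 T) ->
  exists n (T : ltree n), y = Triple T 1 T.
Proof.
elim=> // {x y} x y z [i ->] _ IH [n [T xE]]; apply: IH.
rewrite {}xE /= in i *; exists n.+1, (caret T i).
by rewrite /expand /= csplit1 cperm1 perm1.
Qed.

Lemma thompson_oneE n (T : ltree n) : triple_class (Triple T 1 T) = thompson_one.
Proof.
have [y ry yT] := @reach_to (Triple leaf 1 leaf) (val T) isT.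
have [|m [T' yE]] := reach_id ry; first by exists 1%N, leaf.
rewrite /thompson_one (_ : triple_class (Triple leaf 1 leaf) = triple_class y).
  rewrite yE /tsrc /= in yT *.
  have nm : n = m := ltree_size (esym yT).
  by case: _ / nm T' yT {yE} => T' /val_inj <-.
by apply/triple_classP/reach_tequiv.
Qed.

Definition thompson_inv (X : thompson) : thompson := triple_class (tinv (repr X)).

Lemma thompson_invE x : thompson_inv (triple_class x) = triple_class (tinv x).
Proof.
apply/triple_classP.
have /triple_classP/tequivP[z /reach_inv r1 /reach_inv r2] :=
  triple_class_repr (triple_class x).
by apply/tequivP; exists (tinv z).
Qed.

Lemma thompson_mul1 : left_id thompson_one thompson_mul.
Proof.
elim/thompson_ind=> -[n T a U]; rewrite -(thompson_oneE T).
by rewrite (thompson_mulE (TProd _ _ _ _ _)) mul1g.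
Qed.

Lemma thompson_mulr1 : right_id thompson_one thompson_mul.
Proof.
elim/thompson_ind=> -[n T a U]; rewrite -(thompson_oneE U).
by rewrite (thompson_mulE (TProd _ _ _ _ _)) mulg1.
Qed.

Lemma thompson_mulV : left_inverse thompson_one thompson_inv thompson_mul.
Proof.
elim/thompson_ind=> -[n T a U]; rewrite thompson_invE /tinv /=.
by rewrite (thompson_mulE (TProd _ _ _ _ _)) mulVg thompson_oneE.
Qed.

Lemma thompson_mulVr : right_inverse thompson_one thompson_inv thompson_mul.
Proof.
elim/thompson_ind=> -[n T a U]; rewrite thompson_invE /tinv /=.
by rewrite (thompson_mulE (TProd _ _ _ _ _)) mulgV thompson_oneE.
Qed.

Lemma reach_class x y : reach x y -> triple_class x = triple_class y.
Proof. by move=> r; apply/triple_classP/reach_tequiv. Qed.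

Lemma thompson_mulA : associative thompson_mul.
Proof.
elim/thompson_ind=> x; elim/thompson_ind=> y; elim/thompson_ind=> z.
have [x1 [y1 [u [rx ry p]]]] := tprod_total x y.
have [u1 [z1 [v [ru rz q]]]] := tprod_total u z.
have [x2 [y2 [rx2 ry2 p2]]] := tprod_reach_p p ru.
rewrite (reach_class (reach_trans rx rx2)) (reach_class (reach_trans ry ry2)).
rewrite (reach_class rz) (thompson_mulE p2) (thompson_mulE q).
case: p2 q => n T U W a b /tprod_inv[W' [c [-> ->]]].
by rewrite !(thompson_mulE (TProd _ _ _ _ _)) mulgA.
Qed.

HB.instance Definition _ := isGroup.Build thompson thompson_mulA
  thompson_mul1 thompson_mulr1 thompson_mulV thompson_mulVr.

End Thompson.

Arguments expand {C} x i.

Section Projection.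

Variable C : cloning_system.

Definition triple_perm (x : triple C) : triple perm_cloning :=
  @Triple perm_cloning (arity x) (src x) (cperm (elt x)) (tgt x).

Definition thompson_perm (X : thompson C) : thompson perm_cloning :=
  triple_class (triple_perm (repr X)).

Lemma tstep_perm x y : tstep x y -> tstep (triple_perm x) (triple_perm y).
Proof.
case: x => n T a U [/= i ->]; exists i; rewrite /triple_perm /expand /=.
by rewrite cperm_split.
Qed.

Lemma reach_perm x y : reach x y -> reach (triple_perm x) (triple_perm y).
Proof.
elim=> [x'|x' y' z' /tstep_perm xy _]; first exact: rt1n_refl.
exact: rt1n_trans.
Qed.

Lemma thompson_permE x :
  thompson_perm (triple_class x) = triple_class (triple_perm x).
Proof.
have /triple_classP/tequivP[z /reach_perm r1 /reach_perm r2] :=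
  triple_class_repr (triple_class x).
by apply/triple_classP/tequivP; exists (triple_perm z).
Qed.

Lemma thompson_permM : {morph thompson_perm : X Y / X * Y >-> X * Y}.
Proof.
elim/thompson_ind=> x; elim/thompson_ind=> y.
have [x1 [y1 [z [rx ry p]]]] := tprod_total x y.
rewrite (reach_class rx) (reach_class ry) [_ * _](thompson_mulE p) !thompson_permE.
case: p => n T U W a b; symmetry.
rewrite /triple_perm /= cpermM.
exact: (thompson_mulE (@TProd perm_cloning n T U W (cperm a) (cperm b))).
Qed.

Lemma thompson_perm1 : thompson_perm 1 = 1.
Proof. by rewrite thompson_permE /triple_perm /= cperm1. Qed.

HB.instance Definition _ := isMultiplicative.Build
  (thompson C) (thompson perm_cloning) thompson_perm thompson_permM.
HB.instance Definition _ := Multiplicative_isUMagmaMorphism.Build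
  (thompson C) (thompson perm_cloning) thompson_perm thompson_perm1.

Lemma thompson_permV X : thompson_perm X^-1 = (thompson_perm X)^-1.
Proof. exact: gmulfV. Qed.

End Projection.

Definition BV : groupType := thompson braid_cloning.
Definition V : groupType := thompson perm_cloning.
Definition BV_to_V : BV -> V := @thompson_perm braid_cloning.

Definition pure_BV : {pred BV} := [pred x | BV_to_V x == 1].

Lemma pure_BV_group_closed : group_closed pure_BV.
Proof.
split=> [|X Y]; first by rewrite inE /BV_to_V thompson_perm1.
rewrite !inE /BV_to_V => /eqP X1 /eqP Y1.
by rewrite thompson_permM thompson_permV X1 Y1 invg1 mulg1.
Qed.

Record PBV := InPBV { PBV_val :> BV; _ : PBV_val \in pure_BV }.
HB.instance Definition _ := [isSub of PBV for PBV_val].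
HB.instance Definition _ := [Choice of PBV by <:].
HB.instance Definition _ :=
  SubChoice_isSubGroup.Build BV pure_BV PBV pure_BV_group_closed.

Lemma pure_BVP (X : BV) : X \in pure_BV <->
  exists n (T : ltree n) (p : braid n),
    braid_perm p = 1 /\ X = triple_class (@Triple braid_cloning n T p T).
Proof.
split=> [|[n [T [p [p1 ->]]]]]; last first.
  rewrite inE /BV_to_V thompson_permE /triple_perm /= p1.
  by rewrite [triple_class _]thompson_oneE.
elim/thompson_ind: X => x; rewrite inE /BV_to_V thompson_permE => /eqP.
move=> /triple_classP/tequivP[z r1 r2].
have [|m [W zE]] := reach_id r2; first by exists 1%N, leaf.
have [|y ry yE] := @reach_to braid_cloning x (val W).
  by have := reach_tle r1; rewrite zE.
rewrite (reach_class ry).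
have : triple_perm y = z.
  by apply: (reach_det (reach_perm ry) r1); rewrite zE.
rewrite zE; case: y {ry yE} => n T p U /= e.
have nm : n = m by have := congr1 (@arity _) e.
case: _ / nm W {zE} e => W /triple_inj[/= TW p1 UW].
by exists n, T, p; split=> //; rewrite UW -TW.
Qed.

Definition bi_orderable (G : groupType) : Prop :=
  exists lt : G -> G -> Prop,
    [/\ forall a, ~ lt a a,
        forall a b c, lt a b -> lt b c -> lt a c,
        forall a b, a <> b -> lt a b \/ lt b a &
        forall a b c, lt a b -> lt (c * a) (c * b) /\ lt (a * c) (b * c)].

(* Main.v *)
From HB Require Import structures.
From mathcomp Require Import all_boot all_order all_algebra all_fingroup.
From mathcomp Require Import boolp classical_sets functions filter zify.
Require Import Defs.
Import GRing.Theory Num.Theory Order.TTheory.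

Set Implicit Arguments.
Unset Strict Implicit.
Unset Printing Implicit Defensive.

Local Open Scope quotient_scope.
Local Open Scope group_scope.

Local Notation repr := generic_quotient.repr.

(* P_n is bi-ordered by induction on n through the extension
   1 -> U -> P_(m+1) -> P_m -> 1 that forgets the last strand. Reading a braid at
   the cosets of the stabilizer of the last position turns the presentation of
   B_(m+1) into crossed homomorphisms: one into B_m (forgetting a strand) and one
   into the additive automorphisms of the noncommutative power series in
   x_0, ..., x_(m-1), in which the band generator A_i of U acts as left
   multiplication by 1 + x_i and sigma_j as an algebra automorphism. The action
   of pure braids is unipotent for the filtration by degree, and on U it is the
   Magnus expansion, which detects freely reduced words. A pure braid is positive
   if its image in P_m is, or if it lies in U and the first nonzero coefficient
   of its Magnus expansion minus 1 is positive; unipotence makes this invariant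
   under conjugation.

   Splitting a strand is injective, being undone by forgetting, so the braids on
   a fixed tree form a copy of P_n in PBV. These copies are directed, and
   bi-orderability is a local property by compactness. *)

(** * Crossed homomorphisms on braid groups *)

Section Cocycle.

Variables (n : nat) (G : groupType) (c : nat -> nat -> G).

(** [c i j] is the value of the generator [j] read from position [i]. The two compatibilities are
    the Artin relations read along the moving position; they let [c] descend to a crossed
    homomorphism on braids. *)
Definition far_compatible := forall i j k, i < n -> j.+1 < k -> k.+1 < n ->
  c i j * c (tpn j i) k = c i k * c (tpn k i) j.

Definition adj_compatible := forall i j, i < n -> j.+2 < n ->
  c i j * c (tpn j i) j.+1 * c (tpn j.+1 (tpn j i)) j
  = c i j.+1 * c (tpn j.+1 i) j * c (tpn j (tpn j.+1 i)) j.+1.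

Definition letter_cocycle (i : 'I_n) (l : 'I_n.-1 * bool) : G :=
  if l.2 then (c (letter_perm l i) l.1)^-1 else c i l.1.

Fixpoint word_cocycle (i : 'I_n) (w : seq ('I_n.-1 * bool)) : G :=
  if w is l :: w' then letter_cocycle i l * word_cocycle (letter_perm l i) w'
  else 1.

Definition cocycle (i : 'I_n) (b : braid n) : G := word_cocycle i (repr b).

Lemma word_cocycle_cat i u v :
  word_cocycle i (u ++ v) = word_cocycle i u * word_cocycle (word_perm u i) v.
Proof.
elim: u i => [|l u IH] i /=; first by rewrite mul1g word_perm_nil perm1.
by rewrite IH mulgA word_perm_cons permM.
Qed.

Hypotheses (c_far : far_compatible) (c_adj : adj_compatible).

Lemma artin_rel_cocycle u v i : artin_rel u v -> word_cocycle i u = word_cocycle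
  i v.
Proof.
case=> j k /orP[] jk /=; rewrite !mulg1 /letter_cocycle /= !letter_permE.
- by apply: c_far => //; have := ltn_ord k; lia.
- by symmetry; apply: c_far => //; have := ltn_ord j; lia.
- rewrite -(eqP jk) !mulgA; apply: c_adj => //.
  by have := ltn_ord k; lia.
- rewrite -(eqP jk) !mulgA; symmetry; apply: c_adj => //.
  by have := ltn_ord j; lia.
Qed.

Lemma pres_eq_cocycle u v i : pres_eq (@artin_rel n) u v ->
  word_cocycle i u = word_cocycle i v.
Proof.
move=> uv; elim: uv i => {u v} [u|u v _ uv|u v w _ uv _ vw|u u' v v' uE uu _
  vv|j e|u v uv] i.
- by [].
- by rewrite uv.
- by rewrite uv vw.
- rewrite !word_cocycle_cat uu vv.
  by have [-> _] := pres_eq_split uE.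
- rewrite /= mulg1 /letter_cocycle /=; case: e => /=.
    by rewrite -/(letter_perm (j, true)) mulVg.
  by rewrite letter_permK mulgV.
- exact: artin_rel_cocycle.
Qed.

Lemma cocycle_word i w : cocycle i (word_class (@artin_rel n) w) = word_cocycle
  i w.
Proof. exact/pres_eq_cocycle/pres_eq_repr. Qed.

Lemma cocycle1 i : cocycle i 1 = 1.
Proof. by rewrite cocycle_word. Qed.

Lemma cocycleM i (a b : braid n) :
  cocycle i (a * b) = cocycle i a * cocycle (braid_perm a i) b.
Proof.
elim/pres_ind: a => u; elim/pres_ind: b => v.
by rewrite -word_class_cat !cocycle_word braid_perm_word word_cocycle_cat.
Qed.

Lemma cocycleV i (a : braid n) :
  cocycle i a^-1 = (cocycle ((braid_perm a)^-1 i) a)^-1.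
Proof.
apply: (mulgI (cocycle ((braid_perm a)^-1 i) a)).
rewrite mulgV -[X in _ * cocycle X _](permKV (braid_perm a)) -cocycleM.
by rewrite mulgV cocycle1.
Qed.

Lemma cocycle_sigma i (j : 'I_n.-1) : cocycle i (sigma j) = c i j.
Proof. by rewrite cocycle_word /= mulg1. Qed.

Lemma cocycle_sg i k : k.+1 < n -> cocycle i (sg n k) = c i k.
Proof.
move=> lt_k; have lt_k' : k < n.-1 by lia.
by rewrite /sg insubT cocycle_sigma.
Qed.

End Cocycle.

(* A system records the relations between the generators A_{i,m} (images L i) of
   the free kernel of forgetting the last of m + 1 strands and the generators
   of B_m (images s j). *)
Record strand_system (m : nat) (G : groupType) (L s : nat -> G) : Prop :=
  StrandSystem {
  sys_far : forall j i, j.+1 < m -> i < m -> i <> j -> i <> j.+1 ->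
    s j * L i = L i * s j;
  sys_l : forall j, j.+1 < m -> s j * L j = L j.+1 * s j;
  sys_lr : forall j, j.+1 < m -> s j * (L j * L j.+1) = L j * L j.+1 * s j;
  sys_s_far : forall j k, j.+1 < k -> k.+1 < m -> s j * s k = s k * s j;
  sys_s_adj : forall j, j.+2 < m ->
    s j * s j.+1 * s j = s j.+1 * s j * s j.+1 }.

(* The Reidemeister-Schreier rewriting of the generator j read at the coset of
   the braids that move the last strand to position i. *)
Definition schreier (G : groupType) (L s : nat -> G) (i j : nat) : G :=
  if i < j then s j.-1 else if i == j then L j
  else if i == j.+1 then 1 else s j.

Section System.

Variables (m : nat) (G : groupType) (L s : nat -> G).

Lemma schreier_lt i j : i < j -> schreier L s i j = s j.-1.
Proof. by rewrite /schreier => ->. Qed.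

Lemma schreier_l i j : i = j -> schreier L s i j = L j.
Proof. by rewrite /schreier => ->; rewrite ltnn eqxx. Qed.

Lemma schreier_r i j : i = j.+1 -> schreier L s i j = 1.
Proof.
by rewrite /schreier => ->; rewrite eqxx ltnNge leqnSn [_ == j]eqn_leq ltnn.
Qed.

Lemma schreier_gt i j : j.+1 < i -> schreier L s i j = s j.
Proof.
move=> ji; rewrite /schreier ltnNge (ltnW (ltnW ji)) /= !gtn_eqF //.
exact: ltnW.
Qed.

Ltac eval_tpn :=
  repeat match goal with
  | |- context [tpn ?j ?i] =>
      first [ rewrite (@tpn_l j i); [|lia] | rewrite (@tpn_r j i); [|lia]
            | rewrite (@tpn_n j i); [|lia|lia] ]
  end.

Ltac eval_schreier :=
  eval_tpn;
  repeat match goal with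
  | |- context [schreier ?L ?s ?i ?j] =>
      first [ rewrite (@schreier_lt i j); [|lia]
            | rewrite (@schreier_l i j); [|lia]
            | rewrite (@schreier_r i j); [|lia]
            | rewrite (@schreier_gt i j); [|lia] ]
  end; rewrite ?mulg1 ?mul1g.

Hypothesis sys : strand_system m L s.

Lemma schreier_far : far_compatible m.+1 (schreier L s).
Proof.
move=> i j k lt_i jk lt_k; have [k' kE] : exists k', k = k'.+1 by exists k.-1;
  lia.
have [?|[?|[?|[?|[?|[?|?]]]]]] : i < j \/ i = j \/ i = j.+1 \/
  (j.+1 < i /\ i < k) \/ i = k \/ i = k.+1 \/ k.+1 < i by lia.
all: eval_schreier => //.
- by apply: (sys_s_far sys); lia.
- by symmetry; apply: (sys_far sys); lia.
- by apply: (sys_s_far sys); lia.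
- by apply: (sys_far sys); lia.
- by apply: (sys_s_far sys); lia.
Qed.

(** The five positions of [i] turn the adjacent relation into, in order, the adjacent relation for
    [s], [sys_lr], [sys_l], a trivial identity, and again the adjacent relation for [s]. *)
Lemma schreier_adj : adj_compatible m.+1 (schreier L s).
Proof.
move=> i j lt_i lt_j.
have [?|[?|[?|[?|?]]]] :
  i < j \/ i = j \/ i = j.+1 \/ i = j.+2 \/ j.+2 < i by lia.
- eval_schreier; have -> : j.+1.-1 = j.-1.+1 by lia.
  by apply: (sys_s_adj sys); lia.
- by eval_schreier; rewrite -[RHS]mulgA (sys_lr sys).
- by eval_schreier; rewrite (sys_l sys).
- by eval_schreier.
- by eval_schreier; apply: (sys_s_adj sys); lia.
Qed.

Lemma const_far : far_compatible m (fun _ => s).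
Proof. by move=> i j k _ jk lt_k; apply: (sys_s_far sys). Qed.

Lemma const_adj : adj_compatible m (fun _ => s).
Proof. by move=> i j _ lt_j; apply: (sys_s_adj sys). Qed.

End System.

(** A cocycle whose values ignore the position is a homomorphism, here the one sending sigma_j to
    [s j]; the base position [ord0] is arbitrary. *)
Definition section_map m (G : groupType) (s : nat -> G) : braid m.+1 -> G :=
  cocycle (fun _ => s) ord0.

Section SectionMap.

Variables (m : nat) (G : groupType) (L s : nat -> G).
Hypothesis sys : strand_system m.+1 L s.
Local Notation kappa := (@section_map m G s).

Let word_const i i' w : word_cocycle (n := m.+1) (fun _ => s) i w
  = word_cocycle (fun _ => s) i' w.
Proof. by elim: w i i' => //= l w IH i i';
  rewrite (IH _ (@letter_perm m.+1 l i')). Qed.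

Lemma section_map1 : kappa 1 = 1.
Proof. exact: cocycle1 (const_far sys) (const_adj sys) _. Qed.

Lemma section_mapM a b : kappa (a * b) = kappa a * kappa b.
Proof.
rewrite /section_map (cocycleM (const_far sys) (const_adj sys)).
by congr (_ * _); apply: word_const.
Qed.

Lemma section_mapV a : kappa a^-1 = (kappa a)^-1.
Proof. by apply: (mulgI (kappa a));
  rewrite -section_mapM !mulgV section_map1. Qed.

Lemma section_map_sg k : k < m -> kappa (sg m.+1 k) = s k.
Proof. by move=> ?; apply: cocycle_sg (const_far sys) (const_adj sys) _ _ _.
  Qed.

End SectionMap.

(** * Forgetting a strand *)

Section Forget.

Variable n : nat.

Lemma forget_system : strand_system n (fun _ => 1 : braid n) (@sg n).
Proof.
split=> *; rewrite ?mulg1 ?mul1g //; [exact: sg_far | exact: sg_adj].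
Qed.

(** Sending the generators of the free kernel to 1 erases the strand that starts at the given
    position and renumbers the others. *)
Definition forget : 'I_n.+1 -> braid n.+1 -> braid n :=
  cocycle (schreier (fun _ => 1) (@sg n)).

Let ffar := schreier_far forget_system.
Let fadj := schreier_adj forget_system.

Lemma forget1 i : forget i 1 = 1.
Proof. exact: cocycle1. Qed.

Lemma forgetM i a b : forget i (a * b) = forget i a * forget (braid_perm a i) b.
Proof. exact: cocycleM. Qed.

Lemma forgetV i a : forget i a^-1 = (forget ((braid_perm a)^-1 i) a)^-1.
Proof. exact: cocycleV. Qed.

Lemma forget_sg i k : k < n -> forget i (sg n.+1 k) = schreier (fun _ => 1) (@sg
  n) i k.
Proof. by move=> ?; apply: cocycle_sg. Qed.

(** Erasing the left one of the two parallel copies undoes the doubling. Both operations are crossed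
    homomorphisms and the left copy follows the split strand, so generators suffice. *)
Lemma splitK (i : 'I_n) (b : braid n) : forget (lcopy i) (split i b) = b.
Proof.
elim/braid_ind: b i => [|j|a b IHa IHb|a IH] i.
- by rewrite split1 forget1.
- rewrite split_sigmaP split_sigmaE -sgE.
  have lt_j := rpos_subproof j.
  have lt_i := ltn_ord i.
  case: (cases4 i j) => ij.
  + by rewrite ssg_lt // forget_sg ?schreier_lt //=; lia.
  + rewrite ssg_l // forgetM !forget_sg // ?sg_perm /=; try lia.
    rewrite schreier_lt ?tpn_n /=; try lia.
    by rewrite schreier_l ?mulg1.
  + rewrite ssg_r // forgetM !forget_sg // ?sg_perm /=; try lia.
    rewrite schreier_r ?tpn_r //= mul1g schreier_lt //; lia.
  + by rewrite ssg_gt // forget_sg ?schreier_gt //; lia.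
- by rewrite splitM forgetM IHa braid_perm_split split_perm_lcopy IHb.
- rewrite splitV forgetV braid_perm_split.
  have -> : (split_perm ((braid_perm a)^-1 i) (braid_perm a))^-1 (lcopy i)
      = lcopy ((braid_perm a)^-1 i).
    apply: (perm_inj (s := split_perm ((braid_perm a)^-1 i) (braid_perm a))).
    by rewrite permKV split_perm_lcopy permKV.
  by rewrite IH.
Qed.

Lemma split_inj (i : 'I_n) : injective (split i).
Proof. exact: can_inj (@splitK i). Qed.

End Forget.

(** * Combing the last strand *)

Section LastStrand.

Variable m : nat.
Local Notation sg := (sg m.+1).

(* rise k = sigma_(m-1) ... sigma_k moves the last strand to position k. *)
Definition rise (k : nat) : braid m.+1 := \prod_(i <- rev (index_iota k m)) sg
  i.

Lemma riseE k : k < m -> rise k = rise k.+1 * sg k.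
Proof.
move=> lt_k; rewrite /rise /index_iota -(subnSK lt_k) /= rev_cons -cats1 big_cat
  big_seq1.
by [].
Qed.

Lemma rise_last : rise m = 1.
Proof. by rewrite /rise /index_iota subnn big_nil. Qed.

Lemma rise_low k j : k <= m -> j.+1 < k -> rise k * sg j = sg j * rise k.
Proof.
move=> le_k jk; have [d dE] : exists d, d = m - k by exists (m - k).
elim: d k dE le_k jk => [|d IH] k dE le_k jk.
  by have -> : k = m by [lia]; rewrite rise_last mul1g mulg1.
rewrite riseE; last lia.
by rewrite -mulgA -(sg_far _ jk) mulgA IH ?mulgA //; lia.
Qed.

(** A crossing that slides through the travelling strand has its index shifted by one. The induction
    starts at [k = j], where this is the adjacent braid relation. *)
Lemma rise_high k j : k <= j -> j.+1 < m -> rise k * sg j.+1 = sg j * rise k.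
Proof.
move=> kj lt_j; have [d dE] : exists d, d = j - k by exists (j - k).
elim: d k dE kj => [|d IH] k dE kj.
  have -> : k = j by lia.
  rewrite riseE; last lia.
  rewrite riseE // -!mulgA [sg j.+1 * _]mulgA -sg_adj; last lia.
  by rewrite !mulgA rise_low.
rewrite riseE; last lia.
by rewrite -mulgA sg_far ?mulgA ?IH ?mulgA //; lia.
Qed.

(** For [i < m] this is the conjugate of sigma_i^2 by [rise i.+1]: the last strand links once with
    the strand at [i] and returns. *)
Definition band (i : nat) : braid m.+1 := rise i * sg i * (rise i.+1)^-1.

Lemma mulVg_comm (x y z : braid m.+1) : x * y = z * x -> y * x^-1 = x^-1 * z.
Proof. by move=> e; apply: (mulgI x); rewrite mulgA e mulgK mulVKg. Qed.

(** This is Artin's action of the braids on the first [m] strands on the free kernel; the relations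
    come from sliding crossings through [rise]. *)
Lemma band_system : strand_system m band sg.
Proof.
have low k j : k <= m -> j.+1 < k -> sg j * (rise k)^-1 = (rise k)^-1 * sg j.
  by move=> le_k jk; apply: mulVg_comm; apply: rise_low.
have high k j : k <= j -> j.+1 < m -> sg j.+1 * (rise k)^-1 = (rise k)^-1 * sg
  j.
  by move=> kj lt_j; apply: mulVg_comm; apply: rise_high.
have comm_lr j : j.+1 < m -> sg j * (band j * band j.+1) = band j * band j.+1 *
  sg j.
  move=> lt_j; rewrite /band -!mulgA !mulKg.
  rewrite -low // [sg j * (rise j * _)]mulgA -rise_high // -!mulgA;
    congr (_ * _).
  by rewrite !mulgA sg_adj; last lia.
have comm_l j : j.+1 < m -> sg j * band j = band j.+1 * sg j.
  move=> lt_j; rewrite /band -[RHS]mulgA -low // !mulgA -rise_high //.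
  rewrite (@riseE j) ?(@riseE j.+1) //; last lia.
  rewrite invgM !mulgA; congr (_ * _).
  rewrite -!mulgA; congr (_ * (_ * _)); rewrite !mulgA (@sg_adj _ j) ?mulgK //.
split=> //; last by move=> j lt_j; apply: sg_adj; lia.
  move=> j i lt_j lt_i ij ij1; rewrite /band.
  have [ltij|ltji] : i < j \/ j.+1 < i by lia.
    rewrite !mulgA -rise_high //; last lia.
    rewrite -(mulgA (rise i)) -sg_far // -!mulgA; congr (_ * (_ * _)).
    exact: high.
  rewrite !mulgA -rise_low //; last lia.
  rewrite -(mulgA (rise i)) sg_far // -!mulgA; congr (_ * (_ * _)).
  by apply: low; lia.
by move=> j k jk _; apply: sg_far.
Qed.

(** Reidemeister-Schreier rewriting: the braids [rise i] represent the cosets of the stabilizer of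
    the last position. When [i] is last and [b] fixes it, both rises are 1 and [b] itself is
    rewritten in bands and crossings of the other strands. *)
Lemma rise_cocycle (i : 'I_m.+1) (b : braid m.+1) :
  rise i * b = cocycle (schreier band sg) i b * rise (braid_perm b i).
Proof.
have bfar := schreier_far band_system; have badj := schreier_adj band_system.
elim/braid_ind: b i => [|j|a b IHa IHb|a IH] i.
- by rewrite braid_perm1 perm1 cocycle1 // mulg1 mul1g.
- have lt_j := rpos_subproof j; have lt_i := ltn_ord i.
  rewrite -sgE cocycle_sg // sg_perm //.
  case: (cases4 i j) => ij.
  + by rewrite schreier_lt // tpn_n; [case: (j : nat) ij lt_j => // j' ij lt_j;
      rewrite rise_high|lia|lia].
  + by rewrite schreier_l // tpn_l // /band ij mulgKV.
  + by rewrite schreier_r // tpn_r // mul1g (@riseE j) // ij.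
  + by rewrite schreier_gt // tpn_n ?rise_low //; lia.
- by rewrite mulgA IHa -mulgA IHb mulgA cocycleM // braid_permM permM.
- rewrite cocycleV // braid_permV; set k := (braid_perm a)^-1 i.
  have := IH k; rewrite permKV => e.
  by apply: (mulIg a); rewrite mulgKV -mulgA e mulKg.
Qed.

End LastStrand.

(** * Words in the band generators and the semidirect decomposition *)

Section Words.

Variable m : nat.
Implicit Types (G : groupType) (w : seq ('I_m * bool)).

Definition ev_letter G (L : nat -> G) (l : 'I_m * bool) : G :=
  if l.2 then (L l.1)^-1 else L l.1.

Definition ev G (L : nat -> G) w : G := \prod_(l <- w) ev_letter L l.

Lemma ev_cat G (L : nat -> G) u v : ev L (u ++ v) = ev L u * ev L v.
Proof. exact: big_cat. Qed.

Lemma ev_cons G (L : nat -> G) l w : ev L (l :: w) = ev_letter L l * ev L w.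
Proof. exact: big_cons. Qed.

Lemma ev_nil G (L : nat -> G) : ev L [::] = 1.
Proof. exact: big_nil. Qed.

Lemma ev_letterN G (L : nat -> G) l : ev_letter L (l.1, ~~ l.2) = (ev_letter L
  l)^-1.
Proof. by case: l => i []; rewrite /ev_letter //= invgK. Qed.

Lemma ev_inv G (L : nat -> G) w : ev L (word_inv w) = (ev L w)^-1.
Proof.
elim: w => [|l w IH]; first by rewrite /word_inv /= ev_nil invg1.
rewrite ev_cons invgM -IH -ev_letterN /word_inv /= rev_cons -cats1 ev_cat.
by rewrite ev_cons ev_nil mulg1.
Qed.

End Words.

Section Decomposition.

Variable m : nat.
Implicit Types (G : groupType) (w : seq ('I_m.+1 * bool)) (b : braid m.+1).

(** The word [w'] is chosen before the group: the same word must serve the braid group and the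
    automorphisms of power series. *)
Definition movable b := forall w, exists w', forall G (L s : nat -> G),
  strand_system m.+1 L s ->
  section_map s b * ev L w = ev L w' * section_map s b.

Lemma movable_letters b :
  (forall i : 'I_m.+1, exists w', forall G (L s : nat -> G),
     strand_system m.+1 L s ->
     section_map s b * L i = ev L w' * section_map s b) ->
  movable b.
Proof.
move=> mov; elim=> [|[i e] w [w2 IH]].
  by exists [::] => G L s _; rewrite !ev_nil mulg1 mul1g.
have [w1 w1P] := mov i.
exists ((if e then word_inv w1 else w1) ++ w2) => G L s sys.
rewrite ev_cons ev_cat -mulgA -(IH _ _ _ sys) !mulgA; congr (_ * _).
have := w1P _ _ _ sys; rewrite /ev_letter /=; case: e => //.
rewrite ev_inv => /esym e; apply: (mulgI (ev L w1)).
by rewrite !mulgA e mulgK mulgV mul1g.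
Qed.

Lemma movableM a b : movable a -> movable b -> movable (a * b).
Proof.
move=> ma mb w; have [w1 w1P] := mb w; have [w2 w2P] := ma w1.
exists w2 => G L s sys; rewrite !(section_mapM sys) -mulgA (w1P _ _ _ sys).
by rewrite mulgA (w2P _ _ _ sys) mulgA.
Qed.

Lemma movable_sigma (j : 'I_m) : movable (sg m.+1 j).
Proof.
apply: movable_letters => i; have lt_j := ltn_ord j.
pose x : 'I_m.+1 := inord j; pose y : 'I_m.+1 := inord j.+1.
have xE : x = j :> nat by rewrite inordK; lia.
have yE : y = j.+1 :> nat by rewrite inordK; lia.
have [iE|nij] := eqVneq (i : nat) j.
  exists [:: (y, false)] => G L s sys; rewrite (section_map_sg sys) //.
  by rewrite /ev big_seq1 /ev_letter /= yE iE (sys_l sys).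
have [iE|nij1] := eqVneq (i : nat) j.+1.
  (* From [sys_l] and [sys_lr]: s_j A_(j+1) s_j^-1 = A_(j+1)^-1 A_j A_(j+1). *)
  exists [:: (y, true); (x, false); (y, false)] => G L s sys.
  rewrite (section_map_sg sys) // !ev_cons ev_nil /ev_letter /= xE yE iE mulg1.
  apply: (mulgI (L j.+1)); rewrite !mulgA mulgV mul1g -(sys_l sys) //.
  by rewrite -(mulgA (s j)) (sys_lr sys).
exists [:: (i, false)] => G L s sys; rewrite (section_map_sg sys) //.
by rewrite /ev big_seq1 /ev_letter /= (sys_far sys) //; apply/eqP.
Qed.

Lemma movable_sigmaV (j : 'I_m) : movable (sg m.+1 j)^-1.
Proof.
apply: movable_letters => i; have lt_j := ltn_ord j.
pose x : 'I_m.+1 := inord j; pose y : 'I_m.+1 := inord j.+1.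
have xE : x = j :> nat by rewrite inordK; lia.
have yE : y = j.+1 :> nat by rewrite inordK; lia.
have flip G (s l v : G) : l * s = s * v -> s^-1 * l = v * s^-1.
  by move=> e; apply: (mulgI s); rewrite mulVKg mulgA -e mulgK.
have [iE|nij] := eqVneq (i : nat) j.
  (* The inverse action: s_j^-1 A_j s_j = A_j A_(j+1) A_j^-1. *)
  exists [:: (x, false); (y, false); (x, true)] => G L s sys.
  rewrite (section_mapV sys) (section_map_sg sys) //; apply: flip.
  rewrite !ev_cons ev_nil /ev_letter /= xE yE iE mulg1 !mulgA -(mulgA (s j)).
  by rewrite (sys_lr sys) // -!mulgA [L j.+1 * _]mulgA -(sys_l sys) // mulgK.
have [iE|nij1] := eqVneq (i : nat) j.+1.
  exists [:: (x, false)] => G L s sys.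
  rewrite (section_mapV sys) (section_map_sg sys) //; apply: flip.
  by rewrite /ev big_seq1 /ev_letter /= xE iE (sys_l sys).
exists [:: (i, false)] => G L s sys.
rewrite (section_mapV sys) (section_map_sg sys) //; apply: flip.
by rewrite /ev big_seq1 /ev_letter /= (sys_far sys) //; apply/eqP.
Qed.

Lemma braid_movable b : movable b.
Proof.
elim/pres_ind: b; elim=> [|[j e] w IH].
  move=> w; exists w => G L s sys.
  by rewrite (section_map1 sys) mul1g mulg1.
rewrite -cat1s word_class_cat; apply: movableM => //.
rewrite word_class_letter -/(sigma _) -(sgE (n := m.+1)).
by case: e; [apply: movable_sigmaV | apply: movable_sigma].
Qed.

(** A normal form, kernel word times section of the forgotten braid, again with one word for all
    strand systems. *)
Definition decomposable (x : braid m.+2) := forall i, exists w,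
  forall G (L s : nat -> G), strand_system m.+1 L s ->
  cocycle (schreier L s) i x = ev L w * section_map s (forget i x).

Lemma braid_decomposable (b : braid m.+2) : decomposable b.
Proof.
elim/braid_ind: b => [|j|a b IHa IHb|a IH] i.
- exists [::] => G L s sys.
  have := schreier_far sys; have := schreier_adj sys => badj bfar.
  by rewrite cocycle1 // forget1 (section_map1 sys) ev_nil mul1g.
- have lt_j : j < m.+1 := ltn_ord j; have lt_i := ltn_ord i.
  pose x : 'I_m.+1 := inord j; have xE : x = j :> nat by rewrite inordK; lia.
  exists (if i == j :> nat then [:: (x, false)] else [::]) => G L s sys.
  have := schreier_far sys; have := schreier_adj sys => badj bfar.
  rewrite -sgE cocycle_sg // forget_sg //.
  case: (cases4 i j) => ij.
  + rewrite !schreier_lt // ltn_eqF // ev_nil mul1g (section_map_sg sys) //.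
    lia.
  + rewrite !schreier_l // ij eqxx (section_map1 sys) mulg1.
    by rewrite /ev big_seq1 /ev_letter /= xE.
  + by rewrite !schreier_r // gtn_eqF ?ij // ev_nil (section_map1 sys) mulg1.
  + rewrite !schreier_gt // gtn_eqF; last exact: ltnW.
    by rewrite ev_nil mul1g (section_map_sg sys) //; lia.
- have [w1 w1P] := IHa i; have [w2 w2P] := IHb (braid_perm a i).
  (* The section of the first factor is moved to the right past the kernel word of the second. *)
  have [w3 w3P] := braid_movable (forget i a) w2.
  exists (w1 ++ w3) => G L s sys.
  have := schreier_far sys; have := schreier_adj sys => badj bfar.
  rewrite cocycleM // forgetM (section_mapM sys) ev_cat (w1P _ _ _ sys).
  by rewrite (w2P _ _ _ sys) mulgA -(mulgA (ev L w1)) (w3P _ _ _ sys) !mulgA.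
- have [w1 w1P] := IH ((braid_perm a)^-1 i).
  have [w2 w2P] := braid_movable (forget ((braid_perm a)^-1 i) a)^-1 (word_inv
    w1).
  exists w2 => G L s sys.
  have := schreier_far sys; have := schreier_adj sys => badj bfar.
  rewrite cocycleV // forgetV (w1P _ _ _ sys) invgM -ev_inv.
  by rewrite -(section_mapV sys) (w2P _ _ _ sys).
Qed.

End Decomposition.

(** * Permutations and forgetting *)

Section PureFiber.

Variable m : nat.

Lemma forget_perm (i : 'I_m.+1) (b : braid m.+1) (x : 'I_m) :
  lift (braid_perm b i) (braid_perm (forget i b) x) = braid_perm b (lift i x).
Proof.
elim/braid_ind: b i x => [|j|a b IHa IHb|a IH] i x.
- by rewrite forget1 !braid_perm1 !perm1.
- rewrite -sgE; case: j => j /= lt_j.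
  have lt_i := ltn_ord i; have lt_x := ltn_ord x.
  rewrite forget_sg //; apply/val_inj => /=.
  rewrite !sg_perm //=.
  case: (cases4 i j) => ij.
  + rewrite schreier_lt // sg_perm; last lia.
    rewrite /tpn /bump; do ?case: ifP => ?; lia.
  + rewrite schreier_l // braid_perm1 perm1 /tpn /bump; do ?case: ifP => ?; lia.
  + rewrite schreier_r // braid_perm1 perm1 /tpn /bump; do ?case: ifP => ?; lia.
  + rewrite schreier_gt // sg_perm; last lia.
    rewrite /tpn /bump; do ?case: ifP => ?; lia.
- by rewrite forgetM !braid_permM !permM IHb IHa.
- rewrite forgetV !braid_permV; set k := (braid_perm a)^-1 i.
  have ik : i = braid_perm a k by rewrite permKV.
  apply: (perm_inj (s := braid_perm a)); rewrite permKV.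
  by rewrite -[k in lift k _]/k -IH permKV -ik.
Qed.

Lemma forget_pure (b : braid m.+1) (i : 'I_m.+1) :
  braid_perm b = 1 -> braid_perm (forget i b) = 1.
Proof.
move=> b1; apply/permP => x; apply: (@lift_inj _ i).
by have := forget_perm i b x; rewrite b1 !perm1.
Qed.

End PureFiber.

(** * The action on noncommutative power series *)

Section AdditiveAut.

Variable V : zmodType.

(** The inverse is stored as data so that the group inverse is immediate; being determined by the
    map, it does not affect equality, as [add_autP] shows. *)
Record add_aut := AddAut {
  add_aut_fun :> V -> V;
  add_aut_inv : V -> V;
  add_aut_is_additive : zmod_morphism add_aut_fun;
  add_aut_funK : cancel add_aut_fun add_aut_inv;
  add_aut_invK : cancel add_aut_inv add_aut_fun }.

HB.instance Definition _ (g : add_aut) :=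
  GRing.isZmodMorphism.Build V V g (add_aut_is_additive g).
HB.instance Definition _ := gen_eqMixin add_aut.
HB.instance Definition _ := gen_choiceMixin add_aut.

Lemma add_autP (g h : add_aut) : g =1 h -> g = h.
Proof.
case: g h => [f f' fB fK f'K] [g g' gB gK g'K] /= fg.
have e : f = g by apply: funext.
have e' : f' = g' by apply: funext => x; rewrite -{1}(g'K x) -fg fK.
by case: _ / e gB gK g'K {fg} => gB; case: _ / e' => gK g'K;
  congr AddAut; apply: Prop_irrelevance.
Qed.

Lemma add_aut_comp_additive (g h : add_aut) : zmod_morphism (g \o h).
Proof. by move=> x y; rewrite /= !raddfB. Qed.

Definition add_aut_mul (g h : add_aut) : add_aut :=
  AddAut (add_aut_comp_additive g h)
    (can_comp (@add_aut_funK g) (@add_aut_funK h))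
    (can_comp (@add_aut_invK h) (@add_aut_invK g)).

Lemma id_additive : zmod_morphism (@id V).
Proof. by []. Qed.

Definition add_aut_one : add_aut :=
  @AddAut id id id_additive (fun _ => erefl) (fun _ => erefl).

Lemma add_aut_inv_additive (g : add_aut) : zmod_morphism (add_aut_inv g).
Proof.
by move=> x y; apply: (can_inj (@add_aut_funK g));
  rewrite raddfB /= !add_aut_invK.
Qed.

Definition add_aut_opp (g : add_aut) : add_aut :=
  AddAut (add_aut_inv_additive g) (@add_aut_invK g) (@add_aut_funK g).

Lemma add_aut_mulA : associative add_aut_mul.
Proof. by move=> f g h; apply: add_autP. Qed.

Lemma add_aut_mul1 : left_id add_aut_one add_aut_mul.
Proof. by move=> f; apply: add_autP. Qed.

Lemma add_aut_mulr1 : right_id add_aut_one add_aut_mul.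
Proof. by move=> f; apply: add_autP. Qed.

Lemma add_aut_mulV : left_inverse add_aut_one add_aut_opp add_aut_mul.
Proof. by move=> f; apply: add_autP => x /=; rewrite add_aut_funK. Qed.

Lemma add_aut_mulVr : right_inverse add_aut_one add_aut_opp add_aut_mul.
Proof. by move=> f; apply: add_autP => x /=; rewrite add_aut_invK. Qed.

HB.instance Definition _ := isGroup.Build add_aut add_aut_mulA
  add_aut_mul1 add_aut_mulr1 add_aut_mulV add_aut_mulVr.

Lemma add_autM (g h : add_aut) x : (g * h) x = g (h x). Proof. by []. Qed.
Lemma add_aut1 x : (1 : add_aut) x = x. Proof. by []. Qed.

Lemma add_autK (g : add_aut) : cancel g (g^-1)%g.
Proof. exact: add_aut_funK. Qed.

Lemma add_autVK (g : add_aut) : cancel (g^-1)%g g.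
Proof. exact: add_aut_invK. Qed.

Lemma add_autD (g : add_aut) x y : (g (x + y) = g x + g y)%R.
Proof. exact: raddfD. Qed.

Lemma add_autB (g : add_aut) x y : (g (x - y) = g x - g y)%R.
Proof. exact: raddfB. Qed.

End AdditiveAut.

(* Functions on words in the alphabet I are noncommutative formal power series
   with integer coefficients in the variables x_i; xl i and xr i are left and right
   multiplication by x_i, and geom i is left multiplication by (1 + x_i)^-1. *)
Section Series.

Variable I : finType.
Local Notation series := (seq I -> int).
Implicit Types (f g : series) (v : seq I) (i : I).

Definition one : series := fun v => if v is [::] then 1%R else 0%R.

Definition xl i f : series :=
  fun v => if v is k :: v' then (if k == i then f v' else 0%R) else 0%R.

Definition xr i f : series :=
  fun v => if rev v is k :: v' then (if k == i then f (rev v') else 0%R) else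
    0%R.

Fixpoint geom i f (v : seq I) : int :=
  if v is k :: v' then (f v - (if k == i then geom i f v' else 0))%R else f v.

Lemma xl_additive i : zmod_morphism (xl i).
Proof.
by move=> f g; apply: funext => -[|k v]; rewrite !fctE /= ?subrr //; case: ifP;
  rewrite ?subrr.
Qed.
HB.instance Definition _ i := GRing.isZmodMorphism.Build series series (xl i)
  (xl_additive i).

Lemma mul1x_additive i : zmod_morphism (fun f => f + xl i f)%R.
Proof. by move=> f g; rewrite raddfB opprD addrACA. Qed.

Lemma mul1xK i : cancel (fun f => f + xl i f)%R (geom i).
Proof.
move=> f; apply: funext; elim=> [|k v IH] /=; first by rewrite !fctE /= addr0.
by case: ifP => ki; rewrite ?IH !fctE /= ki ?addrK // addr0 subr0.
Qed.

Lemma geomK i : cancel (geom i) (fun f => f + xl i f)%R.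
Proof.
by move=> f; apply: funext; case=> [|k v]; rewrite !fctE /= ?addr0 ?subrK.
Qed.

Definition mul1x i : add_aut series :=
  AddAut (mul1x_additive i) (@mul1xK i) (@geomK i).

Definition vanish (k : nat) f := forall v, size v < k -> f v = 0%R.

(* g induces on the associated graded module of the filtration by degree the
   permutation of the variables by p. *)
Definition graded_perm (g : series -> series) (p : {perm I}) :=
  forall k f v, vanish k f -> size v <= k -> g f v = f (map p v).

Lemma graded_perm_vanish (g : series -> series) p k f : graded_perm g p ->
  vanish k f -> vanish k (g f).
Proof.
by move=> gp f0 v lt_v; rewrite (gp k) // ?f0 ?size_map //; apply: ltnW.
Qed.

Lemma map_perm1 v : map (1 : {perm I}) v = v.
Proof. by rewrite -{2}(map_id v); apply: eq_map => i; rewrite perm1. Qed.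

Lemma graded_perm1 : graded_perm (1 : add_aut series) 1.
Proof. by move=> k f v _ _; rewrite map_perm1. Qed.

Lemma graded_permM (g h : add_aut series) p q :
  graded_perm g p -> graded_perm h q -> graded_perm (g * h) (p * q).
Proof.
move=> gp hq k f v f0 le_v; rewrite add_autM (gp k) //; last first.
  exact: graded_perm_vanish hq f0.
rewrite (hq k) ?size_map // -map_comp; congr f.
by apply: eq_map => i; rewrite /= permM.
Qed.

(** The point is that the inverse preserves the filtration. This goes degree by degree: once
    [g^-1 f] vanishes below [j], its degree [j] part is that of [f] with letters permuted. *)
Lemma graded_permV (g : add_aut series) p : graded_perm g p -> graded_perm
  (g^-1)%g (p^-1)%g.
Proof.
move=> gp k f v f0 le_v.
have mapK (w : seq I) : map p (map (p^-1)%g w) = w.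
  by rewrite -map_comp -{2}(map_id w); apply: eq_map => i; rewrite /= permKV.
have f0' : vanish k ((g^-1)%g f).
  suff H j : j <= k -> vanish j ((g^-1)%g f) by apply: H.
  elim: j => [|j IH] lt_j w // lt_w.
  have [lt_w'|] := ltnP (size w) j; first by apply: IH => //; apply: ltnW.
  move=> ge_w; have wj : size w = j by lia.
  rewrite -(mapK w) -(gp j); last by rewrite size_map wj.
    by rewrite add_autVK f0 // size_map wj.
  by apply: IH; apply: ltnW.
rewrite -{2}(add_autVK g f) (gp k) ?size_map //.
by rewrite mapK.
Qed.

Lemma mul1x_graded i : graded_perm (mul1x i) 1.
Proof.
move=> k f v f0 le_v; rewrite map_perm1.
case: v le_v => [|l v] /= lt_v; rewrite !fctE /= ?addr0 //.
by rewrite (f0 v) // if_same addr0.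
Qed.

Lemma mulrz_seriesE f (c : int) v : (f *~ c)%R v = (f v *~ c)%R.
Proof. by case: c => n; rewrite ?NegzE ?mulrNz /= -?pmulrn natmulfctE. Qed.

Lemma const_seriesE (c : int) v :
  (one *~ c)%R v = (if v is [::] then c else 0%R).
Proof.
by rewrite mulrz_seriesE; case: v => [|? ?] /=; rewrite ?mul0rz // intz.
Qed.

Lemma series_expand f :
  f = (one *~ f [::] + \sum_i xl i (fun v => f (i :: v)))%R.
Proof.
apply: funext => -[|i v]; rewrite !fctE const_seriesE fct_sumE /=.
  by rewrite big1 ?addr0.
rewrite add0r (bigD1 i) //= eqxx big1 ?addr0 // => k /negPf ki.
by rewrite eq_sym ki.
Qed.

(** Stripping the first letter of [f] reduces a coefficient of [t f] to one at a shorter word, so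
    induction on the word applies even to infinite series. *)
Lemma rigidity (t : {additive series -> series}) :
  t one = one -> (forall i f, t (xl i f) = xl i (t f)) -> t =1 id.
Proof.
move=> t1 tx f; apply: funext => v.
elim: v f => [|i v IH] f;
  rewrite {1}(series_expand f) raddfD raddfMz raddf_sum /= t1.
  rewrite [in RHS](series_expand f) !fctE; congr (_ + _)%R.
  by rewrite !fct_sumE; apply: eq_bigr => i _; rewrite tx.
rewrite [in RHS](series_expand f) !fctE; congr (_ + _)%R.
rewrite !fct_sumE; apply: eq_bigr => k _; rewrite tx /=.
by case: eqP => // _; rewrite IH.
Qed.

End Series.

(** * Substitution into power series and the swap automorphisms *)

Section Substitution.

Variable I : finType.
Local Notation series := (seq I -> int).
Implicit Types (f g : series) (v : seq I) (i : I).

Definition raises (M : series -> series) :=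
  forall k f, vanish k f -> vanish k.+1 (M f).

Section Recursion.

Variable M : I -> {additive series -> series}.
Hypothesis M_raises : forall i, raises (M i).

(** [M i] stands for left multiplication by the image of x_i. Since each [M i] raises degrees, this
    truncation is exact on words of length less than [k], whence [(size v).+1] in [subst]. *)
Fixpoint subst_upto (k : nat) f : series :=
  if k is k'.+1 then
    (one (I := I) *~ f [::] + \sum_i M i (subst_upto k' (fun v => f (i ::
      v))))%R
  else 0%R.

Definition subst f : series := fun v => subst_upto (size v).+1 f v.

Lemma subst_uptoB k f g : subst_upto k (f - g)%R = (subst_upto k f - subst_upto
  k g)%R.
Proof.
elim: k f g => [|k IH] f g /=; first by rewrite subrr.
rewrite mulrzBr opprD addrACA -sumrB; congr (_ + _)%R.
by apply: eq_bigr => i _; rewrite -raddfB -IH.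
Qed.

Lemma subst_upto_stable j k f : j <= k -> vanish j (subst_upto k f - subst_upto
  j f)%R.
Proof.
elim: j k f => [|j IH] [|k] f //= jk v lt_v.
rewrite opprD addrACA subrr add0r -sumrB fct_sumE big1 // => i _.
by rewrite -raddfB; apply: (@M_raises i j) => //; apply: IH.
Qed.

Lemma subst_vanish k f : vanish k (subst f - subst_upto k f)%R.
Proof.
move=> v lt_v; have := subst_upto_stable f lt_v (ltnSn (size v)).
by rewrite !fctE => /eqP; rewrite subr_eq0 => /eqP ->; rewrite subrr.
Qed.

Lemma substE f : subst f
  = (one (I := I) *~ f [::] + \sum_i M i (subst (fun v => f (i :: v))))%R.
Proof.
apply: funext => v; rewrite {1}/subst /= !fctE !fct_sumE; congr (_ + _)%R.
apply: eq_bigr => i _; apply/esym/eqP; rewrite -subr_eq0; apply/eqP.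
have := @M_raises i (size v) _ (@subst_vanish (size v) (fun v => f (i :: v))).
by move=> /(_ v (ltnSn _)); rewrite raddfB !fctE.
Qed.

Lemma subst_additive : zmod_morphism subst.
Proof. by move=> f g; apply: funext => v; rewrite /subst subst_uptoB. Qed.
HB.instance Definition _ :=
  GRing.isZmodMorphism.Build series series subst subst_additive.

Lemma subst_one : subst (one (I := I)) = one (I := I).
Proof.
rewrite substE /= big1 ?addr0 // => i _.
have -> : (fun v => one (i :: v)) = 0%R :> series by [].
by rewrite !raddf0.
Qed.

Lemma subst_xl i f : subst (xl i f) = M i (subst f).
Proof.
rewrite substE /= mulr0z add0r (bigD1 i) //= big1 ?addr0 => [|k /negPf ki].
  by congr (M i (subst _)); apply: funext => v; rewrite eqxx.
rewrite [X in subst X](_ : _ = 0%R) ?raddf0 //.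
by apply: funext => v; rewrite ki.
Qed.

Lemma subst_preserves_vanish k f : vanish k f -> vanish k (subst f).
Proof.
elim: k f => [//|k IH] f f0 v lt_v; rewrite substE !fctE fct_sumE const_seriesE.
rewrite big1 => [|i _]; first by case: v lt_v => [|? ?] _; rewrite ?f0 ?addr0.
by apply: (@M_raises i k) => //; apply: IH => w lt_w; apply: f0.
Qed.

(** The hypothesis says that the lowest-degree part of [M i] is left multiplication by the variable
    x_l with [p l = i]; only this part is visible on the graded module. *)
Lemma subst_graded (p : {perm I}) :
  (forall i f l v, vanish (size v) f ->
     M i f (l :: v) = if i == p l then f v else 0%R) ->
  graded_perm subst p.
Proof.
move=> Mp k f v; elim: v k f => [|l v IH] k f f0 le_v;
  rewrite substE !fctE fct_sumE.
  rewrite big1 => [|i _]; last by apply: (@M_raises i 0).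
  by rewrite addr0 const_seriesE.
have f0' i : vanish k.-1 (fun w => f (i :: w)).
  by move=> w lt_w; apply: f0 => /=; lia.
have sub0 i : vanish (size v) (subst (fun w => f (i :: w))).
  by apply: subst_preserves_vanish => w lt_w; apply: (f0' i);
    rewrite /= in le_v; lia.
rewrite const_seriesE add0r (bigD1 (p l)) //= big1 ?addr0 => [|i /negPf ip].
  by rewrite Mp // eqxx (IH k.-1) //; rewrite /= in le_v; lia.
by rewrite Mp // ip.
Qed.

End Recursion.

Lemma xl_raises i : raises (xl i).
Proof.
by move=> k f f0 [|l v] //= lt_v; case: ifP => // _; apply: f0.
Qed.

Lemma vanish_mul1x i k f : vanish k f -> vanish k (mul1x i f).
Proof. exact: graded_perm_vanish (mul1x_graded i). Qed.

Lemma vanish_mul1xV i k f : vanish k f -> vanish k ((mul1x i)^-1%g f).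
Proof. exact: graded_perm_vanish (graded_permV (mul1x_graded i)). Qed.

Section Swap.

Variables a b : I.

Definition swap_image i f : series :=
  if i == a then xl b f
  else if i == b then (mul1x b)^-1%g (xl a (mul1x b f)) else xl i f.

Lemma swap_image_additive i : zmod_morphism (swap_image i).
Proof. by move=> f g; rewrite /swap_image; do 2?case: ifP => _;
  rewrite !raddfB. Qed.
HB.instance Definition _ i :=
  GRing.isZmodMorphism.Build series series (swap_image i) (swap_image_additive
    i).

Lemma swap_image_raises i : raises (swap_image i).
Proof.
move=> k f f0; rewrite /swap_image; do 2?case: ifP => _; try exact: xl_raises.
by apply/vanish_mul1xV/xl_raises/vanish_mul1x.
Qed.

(** Left multiplication by the images under the inverse automorphism: x_b goes to x_a, and x_a to (1
    + x_a) x_b (1 + x_a)^-1. *)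
Definition swap_image' i f : series :=
  if i == b then xl a f
  else if i == a then mul1x a (xl b ((mul1x a)^-1%g f)) else xl i f.

Lemma swap_image'_additive i : zmod_morphism (swap_image' i).
Proof. by move=> f g; rewrite /swap_image'; do 2?case: ifP => _;
  rewrite !raddfB. Qed.
HB.instance Definition _ i :=
  GRing.isZmodMorphism.Build series series (swap_image' i) (swap_image'_additive
    i).

Lemma swap_image'_raises i : raises (swap_image' i).
Proof.
move=> k f f0; rewrite /swap_image'; do 2?case: ifP => _; try exact: xl_raises.
by apply/vanish_mul1x/xl_raises/vanish_mul1xV.
Qed.

Local Notation S := (subst swap_image).
Local Notation S' := (subst swap_image').

Let S_xl i f : S (xl i f) = swap_image i (S f).
Proof. exact: subst_xl swap_image_raises _ _. Qed.

Let S'_xl i f : S' (xl i f) = swap_image' i (S' f).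
Proof. exact: subst_xl swap_image'_raises _ _. Qed.

Let mul_swap f : S (mul1x a f) = mul1x b (S f).
Proof. by rewrite raddfD /= S_xl /swap_image eqxx. Qed.

Let mul_swapV f : S ((mul1x a)^-1%g f) = (mul1x b)^-1%g (S f).
Proof. by rewrite -{2}(add_autVK (mul1x a) f) mul_swap add_autK. Qed.

Let mul_swap' f : S' (mul1x b f) = mul1x a (S' f).
Proof. by rewrite raddfD /= S'_xl /swap_image' eqxx. Qed.

Let mul_swapV' f : S' ((mul1x b)^-1%g f) = (mul1x a)^-1%g (S' f).
Proof. by rewrite -{2}(add_autVK (mul1x b) f) mul_swap' add_autK. Qed.

(** By [rigidity] it suffices that the composite fixes 1 and commutes with every [xl i]. *)
Lemma swapK : cancel S S'.
Proof.
apply: (@rigidity _ (S' \o S)) => [|i f] /=.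
  by rewrite !subst_one //;
    [exact: swap_image'_raises | exact: swap_image_raises].
rewrite S_xl /swap_image; case: (eqVneq i a) => [->|ia].
  by rewrite S'_xl /swap_image' eqxx.
case: (eqVneq i b) => [ib|ib].
  rewrite mul_swapV' S'_xl mul_swap' /swap_image' eqxx eq_sym.
  by move: ia; rewrite -ib => /negPf->; rewrite !add_autK.
by rewrite S'_xl /swap_image' (negPf ia) (negPf ib).
Qed.

Lemma swapVK : cancel S' S.
Proof.
apply: (@rigidity _ (S \o S')) => [|i f] /=.
  by rewrite !subst_one //;
    [exact: swap_image_raises | exact: swap_image'_raises].
rewrite S'_xl /swap_image'; case: (eqVneq i b) => [ib|ib].
  by rewrite S_xl /swap_image eqxx ib.
case: (eqVneq i a) => [ia|ia].
  rewrite mul_swap S_xl mul_swapV /swap_image eqxx eq_sym.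
  by move: ib; rewrite ia => /negPf->; rewrite !add_autVK.
by rewrite S_xl /swap_image (negPf ia) (negPf ib).
Qed.

(* The algebra automorphism fixing the variables other than x_a and x_b with
   1 + x_a |-> 1 + x_b and 1 + x_b |-> (1 + x_b)^-1 (1 + x_a) (1 + x_b). *)
Definition swap : add_aut series :=
  AddAut (subst_additive swap_image) swapK swapVK.

Lemma swap_one : swap (one (I := I)) = one (I := I).
Proof. exact: subst_one swap_image_raises. Qed.

Lemma swap_graded : graded_perm swap (tperm a b).
Proof.
apply: (subst_graded swap_image_raises) => i f l v f0.
rewrite /= /swap_image;
  have eqE (x y : I) : (x == tperm a b y) = (y == tperm a b x).
  by apply/eqP/eqP => ->; rewrite tpermK.
rewrite eqE; case: (eqVneq i a) => [->|ia]; first by rewrite tpermL.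
case: (eqVneq i b) => [->|ib]; last by rewrite tpermD // eq_sym.
have b0 : vanish (size v) (mul1x b f) by apply: vanish_mul1x.
rewrite tpermR (graded_permV (mul1x_graded b) (k := (size v).+1)) //;
  last exact: xl_raises.
rewrite invg1 map_perm1 /=; case: ifP => // _.
by rewrite -[(f + _)%R]/(mul1x b f) (@mul1x_graded _ b (size v)) // map_perm1.
Qed.

Lemma swap_l : swap * mul1x a = mul1x b * swap.
Proof. by apply: add_autP => f; apply: mul_swap. Qed.

Lemma swap_r : a != b -> mul1x b * (swap * mul1x b) = mul1x a * mul1x b * swap.
Proof.
move=> ab; apply: add_autP => f; rewrite !add_autM.
have -> : swap (mul1x b f) = (S f + (mul1x b)^-1%g (xl a (mul1x b (S f))))%R.
  by rewrite [LHS]raddfD /= S_xl /swap_image eq_sym (negPf ab) eqxx.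
by rewrite add_autD add_autVK.
Qed.

Lemma swap_far i : i != a -> i != b -> swap * mul1x i = mul1x i * swap.
Proof.
move=> /negPf ia /negPf ib; apply: add_autP => f.
by rewrite !add_autM [swap (mul1x i f)]raddfD /= S_xl /swap_image ia ib.
Qed.

End Swap.
End Substitution.

(** * The strand system of the Magnus representation *)

Section MagnusSystem.

Variable m : nat.
Local Notation I := 'I_m.+1.
Local Notation series := (seq I -> int).

Definition magnus_gen (k : nat) : add_aut series := mul1x (inord k : I).
Definition magnus_swap (k : nat) : add_aut series :=
  swap (inord k : I) (inord k.+1).

Local Notation L := magnus_gen.
Local Notation s := magnus_swap.

Lemma inord_eq (i j : nat) : i < m.+1 -> j < m.+1 -> ((inord i : I) == inord j)
  = (i == j).
Proof. by move=> lt_i lt_j; rewrite -val_eqE /= !inordK. Qed.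

Lemma conj_swap_l j : j.+1 < m.+1 -> L j ^ (s j)^-1 = L j.+1.
Proof. by move=> lt_j; rewrite conjgE invgK mulgA swap_l mulgK. Qed.

Lemma conj_swap_r j : j.+1 < m.+1 -> L j.+1 ^ (s j)^-1 = L j ^ L j.+1.
Proof.
move=> lt_j; rewrite !conjgE invgK; apply: (mulgI (L j.+1)); rewrite mulVKg.
rewrite !mulgA -(mulgA (L j.+1)) swap_r ?mulgK // inord_eq //;
  first by rewrite neq_ltn ltnSn.
exact: ltnW.
Qed.

Lemma conj_swap_far j i : j.+1 < m.+1 -> i < m.+1 -> i <> j -> i <> j.+1 ->
  L i ^ (s j)^-1 = L i.
Proof.
move=> lt_j lt_i /eqP ij /eqP ij1;
  rewrite conjgE invgK mulgA swap_far ?mulgK //.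
  by rewrite inord_eq // ltnW.
by rewrite inord_eq.
Qed.

(** The quotient [g * h^-1] fixes 1 and commutes with every 1 + x_i, hence with every x_i, so
    [rigidity] applies. *)
Lemma add_aut_eq (g h : add_aut series) :
  g (one (I := I)) = one (I := I) -> h (one (I := I)) = one (I := I) ->
  (forall i, i < m.+1 -> L i ^ g = L i ^ h) -> g = h.
Proof.
move=> g1 h1 gh; pose t := g * h^-1.
suff t1 : t = 1 by apply: (mulIg h^-1); rewrite mulgV.
have h1' : (h^-1)%g (one (I := I)) = one (I := I) by rewrite -{1}h1 add_autK.
apply: add_autP; apply: rigidity => [|i f]; first by rewrite [LHS]add_autM h1'.
have ti : L i * t = t * L i.
  by rewrite conjgC /t conjgM gh ?conjgK.
have := congr1 (fun u : add_aut series => u f) ti; rewrite !add_autM.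
rewrite /magnus_gen inord_val => e; apply: (addrI (t f)).
by rewrite -[LHS]add_autD; symmetry.
Qed.

Lemma swap_fix k : (s k)^-1 (one (I := I)) = one (I := I).
Proof. by rewrite -{1}(swap_one (inord k : I) (inord k.+1)) add_autK. Qed.

Lemma magnus_system : strand_system m.+1 L s.
Proof.
have sL j i (X : add_aut series) : L i ^ (s j)^-1 = X -> s j * L i = X * s j.
  by move=> <-; rewrite conjgE invgK mulgA mulgKV.
split.
- by move=> j i *; apply/sL/conj_swap_far.
- by move=> j *; apply/sL/conj_swap_l.
- move=> j lt_j; rewrite mulgA (sL _ _ _ (conj_swap_l lt_j)) -mulgA.
  by rewrite (sL _ _ _ (conj_swap_r lt_j)) mulgA -conjgC.
(* The formulas [conj_swap_l], [conj_swap_r] and [conj_swap_far] conjugate by inverse swaps, so the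
   relation is inverted before it is compared on each [L i]. *)
- move=> j k jk lt_k; apply: invg_inj; rewrite !invgM; apply: add_aut_eq.
  + by rewrite add_autM !swap_fix.
  + by rewrite add_autM !swap_fix.
  move=> i lt_i; rewrite !conjgM.
  have [->|[->|[->|[->|?]]]] : i = j \/ i = j.+1 \/ i = k \/ i = k.+1 \/
    (i <> j /\ i <> j.+1 /\ i <> k /\ i <> k.+1) by lia.
  + by rewrite conj_swap_l ?(@conj_swap_far k) ?conj_swap_l //; lia.
  + by rewrite conj_swap_r ?(@conj_swap_far k) // 1?conj_swap_r 1?conjJg
      ?(@conj_swap_far k) //; lia.
  + by rewrite conj_swap_l ?(@conj_swap_far j) ?conj_swap_l //; lia.
  + by rewrite conj_swap_r ?(@conj_swap_far j) // 1?conj_swap_r 1?conjJg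
      ?(@conj_swap_far j) //; lia.
  + by rewrite !conj_swap_far //; lia.
- move=> j lt_j; apply: invg_inj; rewrite !invgM; apply: add_aut_eq.
  + by rewrite !add_autM !swap_fix.
  + by rewrite !add_autM !swap_fix.
  move=> i lt_i; rewrite !conjgM.
  have aj : L j ^ (s j)^-1 = L j.+1 by apply: conj_swap_l; lia.
  have bj : L j.+1 ^ (s j)^-1 = L j ^ L j.+1 by apply: conj_swap_r; lia.
  have cj : L j.+2 ^ (s j)^-1 = L j.+2 by apply: conj_swap_far; lia.
  have ak : L j ^ (s j.+1)^-1 = L j by apply: conj_swap_far; lia.
  have bk : L j.+1 ^ (s j.+1)^-1 = L j.+2 by apply: conj_swap_l; lia.
  have ck : L j.+2 ^ (s j.+1)^-1 = L j.+1 ^ L j.+2 by apply: conj_swap_r; lia.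
  have [->|[->|[->|?]]] : i = j \/ i = j.+1 \/ i = j.+2 \/
    (i <> j /\ i <> j.+1 /\ i <> j.+2) by lia.
  + by rewrite aj bk cj ak aj bk.
  + by rewrite bj bk cj ck (conjJg (L j)) ak bk conjJg aj cj.
  + by rewrite cj ck (conjJg (L j.+1)) bj cj [RHS]conjJg [in RHS](conjJg (L j))
      ak bk ck -conjJg.
  + by rewrite !conj_swap_far //; lia.
Qed.

End MagnusSystem.

(** * Faithfulness of the Magnus expansion *)

Section FreeReduction.

Variable m : nat.
Implicit Types (l : 'I_m * bool) (w : seq ('I_m * bool)).

Definition flip_letter l := (l.1, ~~ l.2).

Definition reduced w := sorted [rel l k | k != flip_letter l] w.

Definition push l w :=
  if w is k :: w' then if k == flip_letter l then w' else l :: w else [:: l].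

Lemma push_reduced l w : reduced w -> reduced (push l w).
Proof.
case: w => [|k w] //= red_w; case: ifP => kl /=; last by rewrite kl.
exact: path_sorted red_w.
Qed.

Lemma ev_push (G : groupType) (L : nat -> G) l w :
  ev L (push l w) = ev_letter L l * ev L w.
Proof.
case: w => [|k w] /=; first by rewrite ev_cons.
case: eqP => [->|_]; last by rewrite ev_cons.
by rewrite ev_cons ev_letterN mulVKg.
Qed.

Definition reduce w := foldr push [::] w.

Lemma reduce_reduced w : reduced (reduce w).
Proof. by elim: w => //= l w; apply: push_reduced. Qed.

Lemma ev_reduce (G : groupType) (L : nat -> G) w : ev L (reduce w) = ev L w.
Proof. by elim: w => //= l w IH; rewrite ev_push IH ev_cons. Qed.

End FreeReduction.

Section MagnusFree.

Variable m : nat.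
Local Notation I := 'I_m.+1.
Local Notation series := (seq I -> int).
Implicit Types (w : seq (I * bool)) (v : seq I).

Definition magnus w : series :=
  (ev (magnus_gen m) w : add_aut series) (one (I := I)).

Definition sgb (e : bool) : int := if e then (-1)%R else 1%R.

Definition stutter_free v := sorted [rel i k | i != k] v.

(* On words without repeated consecutive letters 1 - x_i and (1 + x_i)^-1 agree. *)
Lemma magnus_cons i e w v : stutter_free v ->
  magnus ((i, e) :: w) v
  = (magnus w v + if v is k :: v' then if k == i then sgb e * magnus w v' else 0
    else 0)%R.
Proof.
rewrite /magnus ev_cons add_autM -/(magnus w) => sv.
rewrite /ev_letter /magnus_gen /= inord_val.
case: e => /=; last first.
  by rewrite !fctE; case: v sv => [|k v] //= _; rewrite mul1r.
case: v sv => [|k v] /= sv; first by rewrite addr0.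
case: eqP => [ki|_]; last by rewrite subr0 ?addr0.
rewrite mulN1r; congr (_ - _)%R.
case: v sv => [|k' v] //= /andP[kk' _].
by rewrite -ki eq_sym (negPf kk') subr0.
Qed.

(** The letters of the successive syllables of [w], with exponents dropped. *)
Fixpoint runs w : seq I :=
  if w is (i, e) :: w' then
    if runs w' is k :: r then if k == i then k :: r else i :: k :: r
    else [:: i]
  else [::].

Lemma runs_stutter_free w : stutter_free (runs w).
Proof.
elim: w => [|[i e] w IH] //=; case: (runs w) IH => [|k r] //= sr.
by case: eqP => //= /eqP; rewrite eq_sym => ->.
Qed.

(** By [magnus_cons] each letter of [v] is supplied by a letter of [w]; as [v] has no repetitions,
    one run of [w] supplies at most one letter. *)
Lemma magnus_support w v : stutter_free v -> magnus w v != 0%R -> subseq v (runs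
  w).
Proof.
elim: w v => [|[i e] w IH] v sv.
  by rewrite /magnus ev_nil; case: v sv => //= ? ? _; rewrite eqxx.
rewrite magnus_cons //.
have sub_cons u : subseq u (runs w) -> subseq u (runs ((i, e) :: w)).
  move=> uw; apply: (subseq_trans uw) => /=; case: (runs w) => // k r.
  by case: ifP => // _; apply: subseq_cons.
have [vw _|vw0] := boolP (magnus w v != 0%R); first by apply/sub_cons/IH.
move: vw0; rewrite negbK => /eqP ->; rewrite add0r.
case: v sv => [|k v] sv; first by rewrite eqxx.
case: (eqVneq k i) => [ki|_]; last by rewrite eqxx.
rewrite mulf_eq0 negb_or => /andP[_ vw].
have sv' : stutter_free v by apply: path_sorted sv.
have := IH _ sv' vw; rewrite ki /=.
case: (runs w) => [|k' r] vr; first by rewrite /= eqxx.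
case: (eqVneq k' i) => [k'i|_]; last by rewrite /= eqxx.
rewrite k'i /= eqxx in vr *; case: v sv vr {vw sv'} => [|k2 v] /=.
  by rewrite sub0seq.
by move=> /andP[kk2 _]; rewrite -ki eq_sym (negPf kk2).
Qed.

(** At the sequence of its runs, a reduced word has as coefficient the product of its syllable
    exponents. The induction tracks the ratio to the coefficient without the first run, whose length
    is [c.+1]. *)
Lemma magnus_runs i e w : reduced ((i, e) :: w) ->
  exists r, [/\ runs ((i, e) :: w) = i :: r, magnus ((i, e) :: w) r != 0%R &
    exists c : nat, magnus ((i, e) :: w) (i :: r)
      = (sgb e * c.+1%:Z * magnus ((i, e) :: w) r)%R].
Proof.
elim: w i e => [|[i2 e2] w IH] i e red_w.
  exists [::]; split=> //;
    first by rewrite magnus_cons //= addr0 /magnus ev_nil.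
  exists 0%N; rewrite !magnus_cons //= eqxx /magnus ev_nil /= addr0 add0r.
  by rewrite !mulr1.
have red_w2 : reduced ((i2, e2) :: w) by apply: path_sorted red_w.
have [r [rE r0 [c cE]]] := IH _ _ red_w2.
have sr2 : stutter_free (i2 :: r) by rewrite -rE; apply: runs_stutter_free.
have sr : stutter_free r by apply: path_sorted sr2.
have [ii2|ii2] := eqVneq i2 i.
  have ee2 : e2 = e.
    have : (i2, e2) != flip_letter (i, e) by case/andP: red_w.
    by rewrite ii2 /flip_letter xpair_eqE /= eqxx /=;
      case: e e2 {IH red_w red_w2 rE r0 c cE} => [] [].
  subst i2 e2.
  have rN : magnus ((i, e) :: (i, e) :: w) r = magnus ((i, e) :: w) r.
    rewrite magnus_cons //; case: r sr2 {rE r0 c cE sr} => [|k r] /=;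
      rewrite ?addr0 //.
    by rewrite eq_sym => /andP[/negPf-> _]; rewrite addr0.
  exists r; split; rewrite ?rN //;
    first by rewrite /= -/(runs ((i, e) :: w)) rE eqxx.
  exists c.+1; rewrite magnus_cons // eqxx cE -[RHS]mulrA -mulrA -mulrDr;
    congr (_ * _)%R.
  by rewrite -[c.+2]addn1 PoszD mulrDl mul1r.
have sir : stutter_free (i :: i2 :: r) by rewrite /= eq_sym ii2.
have rN : magnus ((i, e) :: (i2, e2) :: w) (i2 :: r) = magnus ((i2, e2) :: w)
  (i2 :: r).
  by rewrite magnus_cons // (negPf ii2) addr0.
exists (i2 :: r); split.
- by rewrite /= -/(runs ((i2, e2) :: w)) rE (negPf ii2).
- rewrite rN cE !mulf_neq0 //; by case: (e2).
exists 0%N; rewrite rN magnus_cons // eqxx mulr1.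
(* The word [i :: i2 :: r] is longer than the runs of the tail, so [magnus_support] excludes it. *)
have -> : magnus ((i2, e2) :: w) (i :: i2 :: r) = 0%R; last by rewrite add0r.
apply/eqP; apply: contraT => /(magnus_support sir) /size_subseq.
by rewrite rE /= ltnn.
Qed.

(** A nonempty reduced form would have a nonzero coefficient at a nonempty word, so [w] cancels
    freely to the empty word. *)
Lemma magnus_injective w : magnus w = one (I := I) ->
  forall (G : groupType) (L : nat -> G), ev L w = 1.
Proof.
move=> w1 G L; rewrite -ev_reduce; have := reduce_reduced w.
have: magnus (reduce w) = one (I := I) by rewrite /magnus ev_reduce.
case: (reduce w) => [|[i e] r] mE; first by rewrite ev_nil.
move=> /magnus_runs[u [_ u0 [c]]]; rewrite mE /= => /esym/eqP.
by rewrite -mE !mulf_eq0 (negPf u0) orbF; case: (e).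
Qed.

End MagnusFree.

(** * Automorphisms that are left multiplications *)

Section LeftMultiplication.

Variable I : finType.
Local Notation series := (seq I -> int).
Implicit Types (f : series) (v : seq I) (i : I) (g : add_aut series).

Lemma xr_rcons i f v k : xr i f (rcons v k) = (if k == i then f v else 0%R).
Proof. by rewrite /xr rev_rcons revK. Qed.

Definition commutes_xr g := forall i f, g (xr i f) = xr i (g f).

Lemma commutes_xr1 : commutes_xr 1.
Proof. by []. Qed.

Lemma commutes_xrM g h : commutes_xr g -> commutes_xr h -> commutes_xr (g * h).
Proof. by move=> gx hx i f; rewrite !add_autM hx gx. Qed.

Lemma commutes_xrV g : commutes_xr g -> commutes_xr g^-1%g.
Proof.
by move=> gx i f; rewrite -{1}(add_autVK g f) -gx add_autK.
Qed.

Lemma mul1x_commutes_xr i : commutes_xr (mul1x i).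
Proof.
move=> j f; apply: funext => v; rewrite /= !fctE.
case: (lastP v) => [|u k]; first by rewrite addr0.
rewrite !xr_rcons; case: u => [|l u] /=.
  by rewrite (_ : xr j f [::] = 0%R) // if_same !addr0.
by rewrite xr_rcons; case: (k == j); case: (l == i); rewrite ?addr0.
Qed.

Lemma series_expand_r f :
  f = (one (I := I) *~ f [::] + \sum_i xr i (fun v => f (rcons v i)))%R.
Proof.
apply: funext => v; rewrite !fctE const_seriesE fct_sumE.
case: (lastP v) => [|u k]; first by rewrite big1 ?addr0.
rewrite (bigD1 k) //= xr_rcons eqxx big1 ?addr0 => [|i /negPf ik].
  by case: u => *; rewrite add0r.
by rewrite xr_rcons eq_sym ik.
Qed.

(** An automorphism commuting with right multiplications is left multiplication by [g one], so
    [g f - f] is the product of [g one - one] and [f], and orders of vanishing add. *)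
Lemma left_mul_vanish g (k j : nat) f : commutes_xr g -> vanish k (g (one (I :=
  I)) - one (I := I))%R ->
  vanish j f -> vanish (j + k) (g f - f)%R.
Proof.
move=> gx g1 f0 v.
have expand h : (g h - h = (g (one (I := I)) - one (I := I)) *~ h [::]
    + \sum_i xr i (g (fun v => h (rcons v i)) - (fun v => h (rcons v i))))%R.
  have expand' c F : let h := (one (I := I) *~ c + \sum_i xr i (F i))%R in
    (g h - h = (g (one (I := I)) - one (I := I)) *~ c
      + \sum_i xr i (g (F i) - F i))%R.
    rewrite /= add_autD raddfMz raddf_sum opprD addrACA -sumrB mulrzBl.
    congr (_ + _)%R; apply: eq_bigr => i _; rewrite /= gx.
    apply: funext => u; rewrite !fctE; case: (lastP u) => [|w l];
      first by rewrite subrr.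
    by rewrite !xr_rcons; case: ifP; rewrite ?subrr.
  by rewrite -expand' -series_expand_r.
have {}g1 u : size u < k -> (g (one (I := I)) u - one (I := I) u = 0)%R by
  exact: g1.
elim/last_ind: v j f f0 => [|u i IH] j f f0 lt_v;
  rewrite expand !fctE mulrz_seriesE fct_sumE.
  rewrite big1 // addr0; case: j f0 lt_v => [|j] f0 lt_v;
    first by rewrite g1 ?mul0rz.
  by rewrite f0 ?mulr0z.
rewrite (bigD1 i) //= big1 ?addr0 => [|l /negPf li];
  last by rewrite xr_rcons eq_sym li.
rewrite xr_rcons eqxx (IH j.-1).
- case: j f0 lt_v => [|j] f0 lt_v; first by rewrite g1 ?mul0rz ?addr0.
  by rewrite f0 ?mulr0z ?addr0.
- by move=> w lt_w; apply: f0; rewrite size_rcons; lia.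
by move: lt_v; rewrite size_rcons; lia.
Qed.

End LeftMultiplication.

(** * The order on pure braid groups *)

Section LexicographicOrder.

Variable I : finType.
Local Notation series := (seq I -> int).
Implicit Types (f : series) (u v w : seq I) (g h : add_aut series).

(** Degree comes first so that a change in higher degrees cannot affect the leading coefficient;
    within a degree any enumeration of words will do. *)
Definition before u v :=
  (size u < size v) || (size u == size v) && (pickle u < pickle v).

Lemma before_trans u v w : before u v -> before v w -> before u w.
Proof. rewrite /before; lia. Qed.

Lemma before_total u v : u = v \/ before u v \/ before v u.
Proof.
have [/(pcan_inj pickleK)|] := eqVneq (pickle u) (pickle v); first by left.
by rewrite /before; lia.
Qed.

Definition leads f v := (0 < f v)%R /\ forall u, before u v -> f u = 0%R.

Definition lexpos f := exists v, leads f v.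

Lemma leads_vanish f v : leads f v -> vanish (size v) f.
Proof. by case=> _ f0 u lt_u; apply: f0; rewrite /before lt_u. Qed.

Lemma leads_near f f' v : (forall u, size u <= size v -> f' u = f u) ->
  leads f v -> leads f' v.
Proof.
move=> ff [fv f0]; split=> [|u uv]; rewrite ff //; first exact: f0.
by move: uv; rewrite /before; lia.
Qed.

Lemma lexpos_add f f' : lexpos f -> lexpos f' -> lexpos (f + f')%R.
Proof.
move=> [u [fu f0]] [v [fv f0']].
have [uv|[uv|vu]] := before_total u v.
- exists u; subst v; split=> [|w wu]; rewrite !fctE ?addr_gt0 //.
  by rewrite f0 ?f0' ?addr0.
- exists u; split=> [|w wu]; rewrite !fctE; first by rewrite (f0' u) ?addr0.
  by rewrite f0 ?f0' ?addr0 //; apply: before_trans uv.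
- exists v; split=> [|w wv]; rewrite !fctE; first by rewrite (f0 v) ?add0r.
  by rewrite f0 ?f0' ?addr0 //; apply: before_trans vu.
Qed.

Lemma lexpos0 : ~ lexpos (0%R : series).
Proof. by case=> v [/=]; rewrite ltxx. Qed.

Lemma lexpos_total f : f <> 0%R -> lexpos f \/ lexpos (- f)%R.
Proof.
move=> f0.
have exn : exists n, `[< exists2 v, size v = n & f v <> 0%R >].
  apply: contrapT => no; apply: f0; apply: funext => v; apply: contrapT => fv.
  by apply: no; exists (size v); apply/asboolP; exists v.
case: (ex_minnP exn) => n /asboolP[v0 v0n fv0] min_n.
have exp : exists p, `[< exists v, [/\ size v = n, pickle v = p & f v <> 0%R]
  >].
  by exists (pickle v0); apply/asboolP; exists v0.
case: (ex_minnP exp) => p /asboolP[v [vn vp fv]] min_p.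
have first u : before u v -> f u = 0%R.
  move=> uv; apply: contrapT => fu.
  have := min_n (size u); have := min_p (pickle u) => Hp Hn.
  have {}Hn : n <= size u by apply: Hn; apply/asboolP; exists u.
  have un : size u = n by move: uv; rewrite /before; lia.
  have {}Hp : p <= pickle u by apply: Hp; apply/asboolP; exists u.
  by move: uv; rewrite /before; lia.
have [lt|lt|//] := ltrgt0P (f v).
- by left; exists v.
- right; exists v; split=> [|u uv]; rewrite !fctE ?oppr_gt0 //.
  by rewrite first ?oppr0.
Qed.

Lemma unipotent_leads g f v : graded_perm g 1 -> leads f v -> leads (g f) v.
Proof.
move=> gp fv; apply: leads_near (fv) => u le_u.
by rewrite (gp (size v)) ?map_perm1 //; apply: leads_vanish.
Qed.

Local Notation one := (one (I := I)).

Definition aut_pos g := lexpos (g one - one)%R.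

Lemma aut_pos1 : ~ aut_pos 1.
Proof. by rewrite /aut_pos add_aut1 subrr; apply: lexpos0. Qed.

(** gh(1) - 1 = g(h(1) - 1) + (g(1) - 1), and the unipotent [g] keeps the leading term of h(1) -
    1. *)
Lemma aut_posM g h : graded_perm g 1 -> aut_pos g -> aut_pos h -> aut_pos (g *
  h).
Proof.
move=> gp g0 [v hv]; rewrite /aut_pos add_autM.
rewrite -(subrK (g one) (g (h one))) -add_autB -addrA addrC -[X in lexpos
  X]addrC.
apply: lexpos_add g0; exists v; exact: unipotent_leads.
Qed.

Lemma aut_pos_total g : graded_perm g 1 -> g one <> one -> aut_pos g \/ aut_pos
  g^-1%g.
Proof.
move=> gp g1; have : (g one - one <> 0)%R by move/eqP; rewrite subr_eq0 => /eqP.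
case/lexpos_total => [|[v gv]]; [by left | right; exists v].
have -> : ((g^-1)%g one - one = (g^-1)%g (- (g one - one)))%R.
  by rewrite opprB add_autB add_autK.
by apply: unipotent_leads => //; rewrite -[X in graded_perm _ X]invg1;
  apply: graded_permV.
Qed.

(** Conjugation gives h^-1 (g(h(1)) - h(1)). Since h(1) has constant term 1 and [g] is a left
    multiplication, g(h(1)) - h(1) has the leading term of g(1) - 1, which the unipotent h^-1
    keeps. *)
Lemma aut_posJ g h : commutes_xr g -> graded_perm h 1 -> aut_pos g -> aut_pos (g
  ^ h)%g.
Proof.
move=> gx hp [v gv]; exists v; rewrite conjgE !add_autM.
have -> : ((h^-1)%g (g (h one)) - one = (h^-1)%g (g (h one) - h one))%R.
  by rewrite add_autB add_autK.
apply: unipotent_leads; first by rewrite -[X in graded_perm _ X]invg1;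
  apply: graded_permV.
(* One degree gained here makes the error vanish up to and including the degree of [v]. *)
have c0 : vanish 1 (h one - one)%R.
  move=> u; rewrite ltnS leqn0 => /nilP ->.
  by rewrite !fctE (hp 0%N) // subrr.
apply: leads_near (gv) => u le_u; apply/eqP; rewrite -subr_eq0; apply/eqP.
have := left_mul_vanish gx (leads_vanish gv) c0.
move=> /(_ u); rewrite add1n ltnS => /(_ le_u) <-; rewrite add_autB !fctE.
lia.
Qed.

End LexicographicOrder.

(** The positive cone of a bi-order on P_n, given as a predicate on all braids that is constrained
    only at pure ones. *)
Definition pure_cone n (P : braid n -> Prop) :=
  [/\ ~ P 1,
      forall a b, braid_perm a = 1 -> braid_perm b = 1 -> P a -> P b -> P (a *
        b),
      forall a, braid_perm a = 1 -> a <> 1 -> P a \/ P a^-1 &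
      forall a c, braid_perm a = 1 -> braid_perm c = 1 -> P a -> P (a ^ c)].

(** * Lifting a positive cone from P_(m+1) to P_(m+2) *)

Section Fiber.

Variable m : nat.
Local Notation I := 'I_m.+1.
Local Notation L := (@magnus_gen m).
Local Notation s := (@magnus_swap m).
Implicit Types (a b : braid m.+2).

Definition fiber_rep : 'I_m.+2 -> braid m.+2 -> add_aut (seq I -> int) :=
  cocycle (schreier L s).

Let Lfar := schreier_far (magnus_system m).
Let Ladj := schreier_adj (magnus_system m).

Lemma sg_tperm n k : k.+1 < n.+1 -> braid_perm (sg n.+1 k) = tperm (inord k)
  (inord k.+1).
Proof.
move=> lt_k; rewrite /sg insubT braid_perm_sigma.
by congr tperm; apply: val_inj => /=; rewrite inordK //; apply: ltnW.
Qed.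

(** The statement covers all braids and positions so that it can be checked on generators; for pure
    braids it says that the action is unipotent. *)
Lemma fiber_rep_graded i b : graded_perm (fiber_rep i b) (braid_perm (forget i
  b)).
Proof.
elim/braid_ind: b i => [|j|a b IHa IHb|a IH] i.
- rewrite /fiber_rep cocycle1 // forget1 braid_perm1; exact: graded_perm1.
- rewrite -sgE; case: j => j /= lt_j; have lt_i := ltn_ord i.
  rewrite /fiber_rep cocycle_sg // forget_sg //.
  case: (cases4 i j) => ij.
  + rewrite !schreier_lt // sg_tperm; last lia.
    exact: swap_graded.
  + by rewrite !schreier_l // braid_perm1; apply: mul1x_graded.
  + by rewrite !schreier_r // braid_perm1; apply: graded_perm1.
  + rewrite !schreier_gt // sg_tperm; last lia.
    exact: swap_graded.
- rewrite /fiber_rep cocycleM // forgetM braid_permM.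
  by apply: graded_permM; [apply: IHa | apply: IHb].
- rewrite /fiber_rep cocycleV // forgetV braid_permV.
  by apply: graded_permV; apply: IH.
Qed.

(** The uniform word of [braid_decomposable] is read in two strand systems: the bands, where it
    gives [b] back, and the series, where it gives the Magnus expansion. *)
Lemma fiber_rep_ev b : braid_perm b = 1 -> forget ord_max b = 1 ->
  exists w : seq (I * bool), b = ev (band m.+1) w /\ fiber_rep ord_max b = ev L
    w.
Proof.
move=> b1 f1; have [w wP] := braid_decomposable b ord_max.
exists w; split; last first.
  by rewrite /fiber_rep (wP _ _ _ (magnus_system m)) f1 (section_map1
    (magnus_system m)) mulg1.
have := rise_cocycle ord_max b.
rewrite b1 perm1 (wP _ _ _ (band_system m.+1)) f1 (section_map1 (band_system
  m.+1)).
by rewrite rise_last mul1g !mulg1.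
Qed.

Lemma fiber_rep_faithful b : braid_perm b = 1 -> forget ord_max b = 1 ->
  fiber_rep ord_max b (one (I := I)) = one (I := I) -> b = 1.
Proof.
move=> b1 f1; have [w [-> ->]] := fiber_rep_ev b1 f1.
by move=> w1; apply: (magnus_injective (w := w)).
Qed.

Lemma fiber_rep_commutes_xr b : braid_perm b = 1 -> forget ord_max b = 1 ->
  commutes_xr (fiber_rep ord_max b).
Proof.
move=> b1 f1; have [w [_ ->]] := fiber_rep_ev b1 f1.
elim: w => [|[i e] w IH]; first by rewrite ev_nil; apply: commutes_xr1.
rewrite ev_cons; apply: commutes_xrM => //; rewrite /ev_letter /=.
by case: e; rewrite /magnus_gen; [apply: commutes_xrV|];
  apply: mul1x_commutes_xr.
Qed.

Definition fiber_cone (P : braid m.+1 -> Prop) b :=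
  P (forget ord_max b) \/ forget ord_max b = 1 /\ aut_pos (fiber_rep ord_max b).

Lemma fiber_cone_pure P : pure_cone P -> pure_cone (fiber_cone P).
Proof.
case=> P1 PM PV PJ.
have FM a b : braid_perm a = 1 -> forget ord_max (a * b) = forget ord_max a *
  forget ord_max b.
  by move=> a1; rewrite forgetM a1 perm1.
have FV a : braid_perm a = 1 -> forget ord_max a^-1 = (forget ord_max a)^-1.
  by move=> a1; rewrite forgetV a1 invg1 perm1.
have RM a b : braid_perm a = 1 -> fiber_rep ord_max (a * b) = fiber_rep ord_max
  a * fiber_rep ord_max b.
  by move=> a1; rewrite /fiber_rep cocycleM // a1 perm1.
have RV a : braid_perm a = 1 -> fiber_rep ord_max a^-1 = (fiber_rep ord_max
  a)^-1.
  by move=> a1; rewrite /fiber_rep cocycleV // a1 invg1 perm1.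
have Rp a : braid_perm a = 1 -> graded_perm (fiber_rep ord_max a) 1.
  by move=> a1; rewrite -(forget_pure ord_max a1); apply: fiber_rep_graded.
have pV a : braid_perm a = 1 -> braid_perm a^-1 = 1.
  by move=> a1; rewrite braid_permV a1 invg1.
split.
- rewrite /fiber_cone forget1 => -[//|[_]].
  by rewrite /fiber_rep cocycle1 //; apply: aut_pos1.
- move=> a b a1 b1 [Pa|[fa Ra]] [Pb|[fb Rb]]; rewrite /fiber_cone FM // RM //.
  + by left; apply: PM => //; apply: forget_pure.
  + by left; rewrite fb mulg1.
  + by left; rewrite fa mul1g.
  + by right; rewrite fa fb mulg1; split=> //; apply: aut_posM => //; apply: Rp.
- move=> a a1 aN1; rewrite /fiber_cone FV // RV //.
  have [fa|/eqP fa] := eqVneq (forget ord_max a) 1.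
    have [] := @aut_pos_total _ (fiber_rep ord_max a) (Rp _ a1).
    + by move=> R1; apply: aN1; apply: fiber_rep_faithful.
    + by left; right.
    + by right; right; rewrite fa invg1.
  have [] := PV (forget ord_max a) (forget_pure _ a1) fa; first by left; left.
  by right; left.
- move=> a c a1 c1; rewrite /fiber_cone !conjgE FM ?pV // FV // FM // RM ?pV //
    RV // RM //.
  rewrite -!conjgE => -[Pa|[fa Ra]].
    by left; apply: PJ => //; apply: forget_pure.
  right; rewrite fa conj1g; split=> //.
  by apply: aut_posJ => //; [apply: fiber_rep_commutes_xr | apply: Rp].
Qed.

End Fiber.

Theorem pure_braid_cone n : exists P : braid n.+1 -> Prop, pure_cone P.
Proof.
elim: n => [|n [P PP]]; last by exists (fiber_cone P); apply: fiber_cone_pure.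
(* B_1 has no generators, so every element is 1 and the empty cone will do. *)
exists (fun _ => False); split=> // a _ []; elim/pres_ind: a.
by case=> [|[[i //]]].
Qed.

(** * From pure braid groups to PBV *)

Section Compactness.

Variable G : groupType.

(** Only the arguments are confined to [s]; their products, inverses and conjugates may leave it. *)
Definition partial_cone (s : seq G) (P : G -> Prop) :=
  forall a b, a \in s -> b \in s ->
    [/\ ~ P 1, P a -> P b -> P (a * b), a <> 1 -> P a \/ P a^-1 &
      P a -> P (a ^ b)].

(* The cones given for the finite subsets are glued along an ultrafilter
   containing all the sets of finite supersets of a given finite set. *)
Lemma bi_orderable_local : (forall s, exists P, partial_cone s P) ->
  bi_orderable G.
Proof.
move=> /choice[P PP].
pose F : set_system (seq G) := fun A => exists s : seq G, forall t : seq G,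
  {subset s <= t} -> A t.
have FF : ProperFilter F.
  split; first by case=> s /(_ s); apply.
  split; first by exists [::].
  - move=> A B [s sA] [t tB]; exists (s ++ t) => r str; split.
      by apply: sA => x xs; apply: str; rewrite mem_cat xs.
    by apply: tB => x xs; apply: str; rewrite mem_cat xs orbT.
  - by move=> A B AB [s sA]; exists s => t /sA; apply: AB.
have [U [UU FU]] := ultraFilterLemma FF.
have UF : ProperFilter U by exact: ultra_proper.
have UI A B : U A -> U B -> U (A `&` B)%classic by apply: filterI.
have US A B : (A `<=` B)%classic -> U A -> U B by apply: filterS.
(* The limit cone: [a] is positive for almost every [s]. Almost every [s] contains any given
   elements, so each cone axiom passes to the limit. *)
pose Q a := U [set s | P s a]%classic.
have Umem a : U [set s | a \in s]%classic.
  by apply: FU; exists [:: a] => t; apply; rewrite inE.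
have Q1 : ~ Q 1.
  move=> U1; have /filter_ex[s [/= s1 P1]] := UI _ _ (Umem 1) U1.
  by have [] := PP s 1 1 s1 s1.
have QM a b : Q a -> Q b -> Q (a * b).
  move=> Qa Qb; apply: (US _ _ _ (UI _ _ (UI _ _ (Umem a) (Umem b)) (UI _ _ Qa
    Qb))).
  by move=> s [[/= sa sb] [/= Pa Pb]]; have [_ PM _ _] := PP s a b sa sb;
    apply: PM.
have QJ a b : Q a -> Q (a ^ b).
  move=> Qa; apply: (US _ _ _ (UI _ _ (UI _ _ (Umem a) (Umem b)) Qa)).
  by move=> s [[/= sa sb] /= Pa]; have [_ _ _ PJ] := PP s a b sa sb; apply: PJ.
have QT a : a <> 1 -> Q a \/ Q a^-1.
  move=> a1; have [|Ua] := in_ultra_setVsetC [set s | P s a]%classic UU;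
    first by left.
  right; apply: (US _ _ _ (UI _ _ (Umem a) Ua)) => s [/= sa nPa].
  by have [_ _ PT _] := PP s a a sa sa; case: (PT a1).
exists (fun a b => Q (a^-1 * b)); split.
- by move=> a; rewrite mulVg.
- by move=> a b c ab bc; have := QM _ _ ab bc; rewrite mulgA mulgK.
- move=> a b ab; have /QT[] : a^-1 * b <> 1; [|by left|].
    by move=> e; apply: ab; rewrite -[b](mulVKg a) e mulg1.
  by rewrite invgM invgK; right.
- move=> a b c ab; split; first by rewrite invgM -mulgA mulKg.
  by have := QJ _ c ab; rewrite conjgE invgM !mulgA.
Qed.

End Compactness.

(** * Copies of pure braid groups in PBV *)

Section PureBV.

Implicit Types x y z : triple braid_cloning.

Local Notation btriple T p U := (@Triple braid_cloning _ T p U).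

(** Splitting is injective, so expanding a nontrivial braid never makes it trivial. *)
Lemma reach_elt1 x z : reach x z -> elt z = 1 -> elt x = 1.
Proof.
elim=> // {x z} x y z [i ->] _ IH /IH /=.
by rewrite -(split1 i) => /split_inj.
Qed.

Definition pure_triple x := exists n (T : ltree n) (p : braid n),
  braid_perm p = 1 /\ x = btriple T p T.

Lemma reach_pure x y : reach x y -> pure_triple x -> pure_triple y.
Proof.
elim=> // {x y} x y z [i ->] _ IH [n [T [p [p1 xE]]]]; apply: IH.
rewrite {}xE /= in i *; exists n.+1, (caret T i), (split i p); split.
  by rewrite braid_perm_split p1 split_perm1.
by rewrite /expand /= p1 perm1.
Qed.

(** A pure braid sends each leaf to the leaf of the same number, so expansions keep the two trees
    equal and any larger tree can be reached. *)
Lemma pure_expand n m (T : ltree n) (W : ltree m) (p : braid n) :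
  tle (val T) (val W) -> braid_perm p = 1 ->
  exists q : braid m, braid_perm q = 1 /\
    triple_class (btriple T p T) = triple_class (btriple W q W).
Proof.
move=> TW p1; have [y ry yW] := @reach_to _ (btriple T p T) (val W) TW.
have [|k [U [q [q1 yE]]]] := reach_pure ry; first by exists n, T, p.
rewrite (reach_class ry) {}yE /tsrc /= {ry} in yW *.
have km : k = m := ltree_size yW.
case: _ / km W yW {TW} => W /val_inj <-.
by exists q.
Qed.

(** The copies of pure braid groups are directed: joining trees puts finitely many elements into one
    copy. *)
Lemma common_tree (s : seq PBV) : exists n (T : ltree n), forall X, X \in s ->
  exists p : braid n, braid_perm p = 1 /\ PBV_val X = triple_class (btriple T p
    T).
Proof.
elim: s => [|X s [n [T sT]]]; first by exists 1%N, leaf.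
have [k [U [p [p1 XE]]]] : exists n (T : ltree n) (p : braid n),
    braid_perm p = 1 /\ PBV_val X = triple_class (btriple T p T).
  by apply/pure_BVP; apply: (valP X).
pose W := tjoin (val T) (val U).
pose WW : ltree (leaves W) := exist _ W (eqxx (leaves W)).
exists (leaves W), WW => Y; rewrite inE => /predU1P[->|/sT[q [q1 ->]]].
  rewrite XE; have [|r [r1 ->]] := @pure_expand _ _ U WW p _ p1;
    last by exists r.
  exact: tle_joinr.
have [|r [r1 ->]] := @pure_expand _ _ T WW q _ q1; last by exists r.
exact: tle_joinl.
Qed.

(** Equality is reduced to triviality of [p * q^-1]; an expansion shared with an identity triple has
    trivial braid, and [reach_elt1] carries this back. *)
Lemma pure_class_inj n (T : ltree n) (p q : braid n) :
  triple_class (btriple T p T) = triple_class (btriple T q T) -> p = q.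
Proof.
move=> e; apply: (mulIg q^-1); rewrite mulgV.
have : triple_class (btriple T (p * q^-1) T) = thompson_one braid_cloning.
  rewrite -(thompson_mulE (@TProd braid_cloning _ T T T p q^-1)) e.
  by rewrite (thompson_mulE (@TProd braid_cloning _ T T T q q^-1)) mulgV
    thompson_oneE.
rewrite -(@thompson_oneE braid_cloning _ T) => /triple_classP/tequivP[z r1 r2].
apply: (reach_elt1 r1).
have [|k [W ->]] := reach_id r2; first by exists n, T.
by [].
Qed.

End PureBV.

Theorem corollary3p2 : bi_orderable PBV.
Proof.
apply: bi_orderable_local => s; have [n [T sT]] := common_tree s.
have n_gt0 : 0 < n by rewrite -(eqP (valP T)) leaves_gt0.
case: n n_gt0 T sT => // n _ T sT.
have [P [P1 PM PV PJ]] := pure_braid_cone n.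
pose cl (p : braid n.+1) : BV := triple_class (@Triple braid_cloning _ T p T).
have clM p q : cl p * cl q = cl (p * q).
  exact: (thompson_mulE (@TProd braid_cloning _ T T T p q)).
have cl1 : cl 1 = 1 by exact: (@thompson_oneE braid_cloning).
have clV p : (cl p)^-1 = cl p^-1.
  by apply: (mulgI (cl p)); rewrite mulgV clM mulgV cl1.
have clI p q : cl p = cl q -> p = q by apply: pure_class_inj.
have val1 : PBV_val 1 = 1 by [].
have valM X Y : PBV_val (X * Y) = PBV_val X * PBV_val Y by [].
have valV X : PBV_val X^-1 = (PBV_val X)^-1 by [].
(* The partial cone is the image of the cone of P_(n+1) under the embedding [cl] at the common
   tree. *)
exists (fun X => exists2 p, braid_perm p = 1 & PBV_val X = cl p /\ P p) => X Y.
move=> /sT[p [p1 Xp]] /sT[q [q1 Yq]].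
have pV : braid_perm p^-1 = 1 by rewrite braid_permV p1 invg1.
split.
- by case=> r r1 [+ Pr]; rewrite val1 -cl1 => /clI r0; apply: P1; rewrite r0.
- case=> r r1 [+ Pr] [t t1 [+ Pt]]; rewrite Xp Yq => /clI pr /clI qt; subst r t.
  exists (p * q); first by rewrite braid_permM p1 q1 mulg1.
  by split; [rewrite valM Xp Yq clM | apply: PM].
- move=> X1; have pN1 : p <> 1.
    by move=> p0; apply: X1; apply: val_inj; rewrite [LHS]Xp p0 -/(cl 1) cl1.
  case: (PV p p1 pN1) => Pp; [left; exists p | right; exists p^-1] => //.
  by split=> //; rewrite valV Xp clV.
case=> r r1 [+ Pr]; rewrite Xp => /clI pr; subst r.
exists (p ^ q).
  by rewrite conjgE !braid_permM braid_permV p1 q1 mulg1 invg1 mulg1.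
split; last exact: PJ.
by rewrite !conjgE !valM valV Xp Yq clV !clM.
Qed.
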